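(* Let the cost be quadratic, $c(x,y)=\frac12\|x-y\|^2$. Let $\mu_0,\mu_1$ be probability measures on $\mathbb{R}^d$, absolutely continuous with respect to the Lebesgue measure, with finite moments of order $2+\delta$ for some $\delta>0$ and with finite entropy. For $\varepsilon>0$ let $\gamma_\varepsilon$ be the minimizer of the entropic optimal transport problem between $\mu_0$ and $\mu_1$, and let $\gamma_0$ be the optimal transport plan for $\varepsilon=0$. If the Brenier map $T=\nabla f$ from $\mu_0$ to $\mu_1$ is Lipschitz, then $W_2^2(\gamma_\varepsilon,\gamma_0)=\Theta(\varepsilon)$ as $\varepsilon\to0^+$. More precisely: 1. (Without assuming that $T$ is Lipschitz.) There exists $a>0$, depending on the moments $m_{2+\delta}(\mu_i)$, the entropies $H(\mu_i)$ and the dimension $d$, such that, as $\varepsilon\to0^+$ (i.e. for all sufficiently small $\varepsilon>0$), $$a\,\varepsilon\le W_2^2(\gamma_\varepsilon,\gamma_0).$$ 2. If moreover the Brenier map $T$ is $L$-Lipschitz, then there exists $b>0$, depending on $d$, $m_{2+\delta}(\mu_i)$, $H(\mu_i)$ and $L$, such that, as $\varepsilon\to0^+$ (i.e. for all sufficiently small $\varepsilon>0$), $$a\,\varepsilon\le W_2^2(\gamma_\varepsilon,\gamma_0)\le b\,\varepsilon.$$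
   Context: $\Pi(\mu_0,\mu_1)$ is the set of probability measures on $\mathbb{R}^d\times\mathbb{R}^d$ with marginals $\mu_0,\mu_1$. $\mathcal{H}^k$ is the Lebesgue measure on $\mathbb{R}^k$. For a probability measure $\mu$ on $\mathbb{R}^k$ with finite second moment, the entropy is $H(\mu)=H(\mu\mid\mathcal{H}^k)=\int\ln(\mu(x))\,d\mu(x)$ if $\mu$ has density $\mu(x)$, and $+\infty$ otherwise. $m_k(\mu)$ is the moment of order $k$ of $\mu$. For $\varepsilon>0$, $\gamma_\varepsilon$ is the minimizer of $\int c\,d\gamma+\varepsilon H(\gamma\mid\mathcal{H}^{2d})$ over $\gamma\in\Pi(\mu_0,\mu_1)$; $\gamma_0$ is the (unique) minimizer of $\int c\,d\gamma$ over $\Pi(\mu_0,\mu_1)$. The Brenier map is the optimal transport map $T=\nabla f$ from $\mu_0$ to $\mu_1$, where $f$ is a convex function, so $\gamma_0=(\mathrm{Id},T)_\#\mu_0$. $W_2$ is the 2-Wasserstein distance on probability measures on $\mathbb{R}^{2d}$ (Euclidean distance). $f(\varepsilon)=\Theta(\varepsilon)$ means that there are constants $0<a\le b$ with $a\varepsilon\le f(\varepsilon)\le b\varepsilon$ for all small $\varepsilon>0$. *)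

(* Defs.v *)
From HB Require Import structures.
From mathcomp Require Import all_boot all_order all_algebra.
From mathcomp Require Import all_classical all_reals all_analysis.

Set Implicit Arguments.
Unset Strict Implicit.
Unset Printing Implicit Defensive.

Import Order.TTheory GRing.Theory Num.Theory.
Import numFieldNormedType.Exports.

Local Open Scope classical_set_scope.
Local Open Scope ring_scope.

(* 'rV[R]_d carries the sigma-algebra generated by the coordinates, exactly as
   the library does for n.-tuple; it is the Borel sigma-algebra of R^d. *)
Definition rV_display : measure_display -> measure_display.
Proof. exact. Qed.

Section measurable_rV.
Context {R : realType} (n : nat).

Definition rV_coord (i : 'I_n) (x : 'rV[R]_n) : measurableTypeR R := x ord0 i.

Let rV_set0 : g_sigma_preimage rV_coord set0.
Proof. exact: sigma_algebra0. Qed.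

Let rV_setC A : g_sigma_preimage rV_coord A -> g_sigma_preimage rV_coord (~` A).
Proof. exact: sigma_algebraC. Qed.

Let rV_bigcup (F : _^nat) : (forall i, g_sigma_preimage rV_coord (F i)) ->
  g_sigma_preimage rV_coord (\bigcup_i (F i)).
Proof. exact: sigma_algebra_bigcup. Qed.

HB.instance Definition _ := @isMeasurable.Build (rV_display default_measure_display)
  'rV[R]_n (g_sigma_preimage rV_coord) rV_set0 rV_setC rV_bigcup.

Lemma measurable_rV_coord (i : 'I_n) : measurable_fun [set: 'rV[R]_n] (rV_coord i).
Proof.
move=> _ Y mY; rewrite setTI; apply: sub_sigma_algebra => /=.
rewrite -bigcup_seq/=; exists i => /=; first by rewrite mem_index_enum.
by exists Y => //; rewrite setTI.
Qed.

Lemma measurable_fun_rVP d1 (T1 : measurableType d1) (f : T1 -> 'rV[R]_n) :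
  measurable_fun [set: T1] f <->
  forall i, measurable_fun [set: T1] (rV_coord i \o f).
Proof.
split=> [mf i|mf]; first by apply: measurableT_comp mf; exact: measurable_rV_coord.
suff : g_sigma_preimage (fun i => rV_coord i \o f) `<=` measurable.
  rewrite g_sigma_preimage_comp => h _ A mA.
  by apply: h; exists A.
apply: smallest_sub; first exact: sigma_algebra_measurable.
rewrite -bigcup_seq; apply: bigcup_sub => i _.
by move=> A [B mB <-]; exact: mf.
Qed.

End measurable_rV.

(* the product of two sigma-finite measures, with its sigma-finite structure:
   the library instance on m1 \x m2 is only found for subprobabilities *)
Section sigma_finite_product.
Local Open Scope ereal_scope.
Context d1 d2 (T1 : measurableType d1) (T2 : measurableType d2) (R : realType).
Variable m1 : {sigma_finite_measure set T1 -> \bar R}.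
Variable m2 : {sigma_finite_measure set T2 -> \bar R}.

Definition sigma_finite_prod : set (T1 * T2) -> \bar R := m1 \x m2.

HB.instance Definition _ := Measure.on sigma_finite_prod.

Let sigma_finite_prodT : sigma_finite setT sigma_finite_prod.
Proof.
have /sigma_finiteP[F [TF ndF Foo]] := sigma_finiteT m1.
have /sigma_finiteP[G [TG ndG Goo]] := sigma_finiteT m2.
exists (fun n => F n `*` G n).
  rewrite -setXTT TF TG predeqE => -[x y]; split.
    move=> [/= [n _ Fnx] [k _ Gky]]; exists (maxn n k) => //; split.
    - by move: x Fnx; exact/subsetPset/ndF/leq_maxl.
    - by move: y Gky; exact/subsetPset/ndG/leq_maxr.
  by move=> [n _ []/= ? ?]; split; exists n.
move=> k; have [? ?] := Foo k; have [? ?] := Goo k.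
split; first exact: measurableX.
by rewrite /sigma_finite_prod product_measure1E// lte_mul_pinfty// ge0_fin_numE.
Qed.

HB.instance Definition _ := Measure_isSigmaFinite.Build _ _ _
  sigma_finite_prod sigma_finite_prodT.

End sigma_finite_product.

Section lebesgue_rV.
Context {R : realType}.
Local Open Scope ereal_scope.

Definition rV_cons n (z : measurableTypeR R * 'rV[R]_n) : 'rV[R]_n.+1 :=
  row_mx (const_mx z.1 : 'rV[R]_1) z.2.

Definition rV_uncons n (x : 'rV[R]_n.+1) : measurableTypeR R * 'rV[R]_n :=
  (x ord0 ord0, \row_i x ord0 (lift ord0 i)).

Lemma rV_cons0 n z : @rV_cons n z ord0 ord0 = z.1.
Proof.
have := row_mxEl (const_mx z.1 : 'rV[R]_1) z.2 ord0 ord0.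
by rewrite [in RHS]mxE => <-; congr (row_mx _ _ _ _); apply/val_inj.
Qed.

Lemma rV_consS n z i : @rV_cons n z ord0 (lift ord0 i) = z.2 ord0 i.
Proof.
have := row_mxEr (const_mx z.1 : 'rV[R]_1) z.2 ord0 i.
by move=> <-; congr (row_mx _ _ _ _); apply/val_inj.
Qed.

Lemma rV_consK n : cancel (@rV_cons n) (@rV_uncons n).
Proof.
move=> [a v]; rewrite /rV_uncons rV_cons0; congr pair.
by apply/rowP => i; rewrite mxE rV_consS.
Qed.

Lemma measurable_rV_cons n : measurable_fun [set: _] (@rV_cons n).
Proof.
apply/measurable_fun_rVP => i; case: (unliftP ord0 i) => [j ->|->]; last first.
  rewrite (_ : _ \o _ = fst) //.
  by apply/funext => z /=; rewrite /rV_coord rV_cons0.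
rewrite (_ : _ \o _ = rV_coord j \o snd).
  by apply: measurableT_comp; [exact: measurable_rV_coord|].
by apply/funext => z /=; rewrite /rV_coord rV_consS.
Qed.

Lemma measurable_rV_uncons n : measurable_fun [set: _] (@rV_uncons n).
Proof.
apply/measurable_fun_pairP; split.
  exact: (@measurable_rV_coord R n.+1 ord0).
apply/measurable_fun_rVP => i.
rewrite (_ : _ \o _ = rV_coord (lift ord0 i)).
  exact: measurable_rV_coord.
by apply/funext => x /=; rewrite /rV_coord mxE.
Qed.

Section step.
Variables (n : nat) (mu : {sigma_finite_measure set 'rV[R]_n -> \bar R}).

(* image under rV_cons of the product of the Lebesgue measure on R and mu *)
Definition lebesgue_step : set 'rV[R]_n.+1 -> \bar R :=
  pushforward (sigma_finite_prod (@lebesgue_measure R) mu) (@rV_cons n).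

Let mrV_cons A : measurable A -> measurable (@rV_cons n @^-1` A).
Proof. by move=> mA; rewrite -[X in measurable X]setTI; exact: measurable_rV_cons. Qed.

Let step0 : lebesgue_step set0 = 0.
Proof. by rewrite /lebesgue_step /pushforward preimage_set0 measure0. Qed.

Let step_ge0 A : 0 <= lebesgue_step A.
Proof. by rewrite /lebesgue_step /pushforward measure_ge0. Qed.

Let step_sigma_additive : semi_sigma_additive lebesgue_step.
Proof.
move=> F mF tF mUF; rewrite /lebesgue_step /pushforward preimage_bigcup.
apply: measure_semi_sigma_additive.
- by move=> k; exact: mrV_cons.
- apply/trivIsetP => /= i j _ _ ij; rewrite -preimage_setI.
  by move/trivIsetP : tF => /(_ _ _ _ _ ij) ->//; rewrite preimage_set0.
- by rewrite -preimage_bigcup; exact: mrV_cons.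
Qed.

HB.instance Definition _ := isMeasure.Build _ _ _
  lebesgue_step step0 step_ge0 step_sigma_additive.

Let step_sigma_finite : sigma_finite setT lebesgue_step.
Proof.
have [F FT Foo] := sigma_finiteT (sigma_finite_prod (@lebesgue_measure R) mu).
exists (fun k => @rV_uncons n @^-1` F k).
  by rewrite -preimage_bigcup -FT preimage_setT.
move=> k; have [mF Fk] := Foo k; split.
  by rewrite -[X in measurable X]setTI; exact: measurable_rV_uncons.
rewrite /lebesgue_step /pushforward -comp_preimage.
rewrite (_ : _ @^-1` _ = F k)//.
by apply/seteqP; split => z /=; rewrite rV_consK.
Qed.

HB.instance Definition _ := Measure_isSigmaFinite.Build _ _ _
  lebesgue_step step_sigma_finite.

End step.

(* Lebesgue measure on R^n, the n-fold product measure; on R^0 it is the unit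
   mass at the only point *)
Fixpoint lebesgue_rV (n : nat) : {sigma_finite_measure set 'rV[R]_n -> \bar R} :=
  match n with
  | 0 => (\d_ (0%R : 'rV[R]_0))%R
  | n'.+1 => lebesgue_step (lebesgue_rV n')
  end.

Lemma lebesgue_rV_box n (A : 'I_n -> set (measurableTypeR R)) :
  (forall i, measurable (A i)) ->
  lebesgue_rV n [set x | forall i, A i (rV_coord i x)] =
  \prod_(i < n) lebesgue_measure (A i).
Proof.
elim: n A => [|n IH] A mA.
  by rewrite big_ord0 /= diracE mem_set // => -[].
rewrite big_ord_recl -IH// /= /lebesgue_step /pushforward.
rewrite -[RHS](product_measure1E (@lebesgue_measure R) (lebesgue_rV n))//.
  congr (_ _); apply/seteqP; split => -[a v] /=.
    move=> H; split; first by have := H ord0; rewrite /rV_coord rV_cons0.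
    by move=> i; have := H (lift ord0 i); rewrite /rV_coord rV_consS.
  move=> [Ha Hv] i; case: (unliftP ord0 i) => [j ->|->].
    by rewrite /rV_coord rV_consS; exact: Hv.
  by rewrite /rV_coord rV_cons0.
rewrite (_ : [set _ | _] =
    \bigcap_(i in [set: 'I_n]) (rV_coord i @^-1` A (lift ord0 i))).
  apply: fin_bigcap_measurable => // i _; rewrite -[X in measurable X]setTI.
  exact: measurable_rV_coord.
by apply/seteqP; split => x /= H i; [move=> _|]; exact: H.
Qed.

End lebesgue_rV.

Section euclidean.
Context {R : realType} (d : nat).
Implicit Types x y : 'rV[R]_d.

Definition edot x y : R := \sum_(i < d) x ord0 i * y ord0 i.

(* Euclidean norm; the library norm `|x| on matrices is the sup norm *)
Definition enorm x : R := Num.sqrt (edot x x).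

(* Euclidean norm of R^2d = R^d * R^d *)
Definition enorm2 (z : 'rV[R]_d * 'rV[R]_d) : R :=
  Num.sqrt (enorm z.1 ^+ 2 + enorm z.2 ^+ 2).

Definition quad_cost (z : 'rV[R]_d * 'rV[R]_d) : R :=
  2^-1 * enorm (z.1 - z.2) ^+ 2.

Definition elipschitz (L : R) (T : 'rV[R]_d -> 'rV[R]_d) : Prop :=
  forall x y, enorm (T x - T y) <= L * enorm (x - y).

Definition is_gradient (f : 'rV[R]_d -> R^o) x (v : 'rV[R]_d) : Prop :=
  differentiable f x /\ forall h, 'd f x h = edot v h.

Definition moment (p : R) (mu : probability 'rV[R]_d R) : \bar R :=
  \int[mu]_x (enorm x `^ p)%:E.

End euclidean.

Local Open Scope ereal_scope.

(* H(mu | nu), the density being the Radon-Nikodym derivative *)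
Definition entropy d (T : measurableType d) (R : realType)
    (nu : {sigma_finite_measure set T -> \bar R}) (mu : probability T R) : \bar R :=
  if `[< mu `<< nu >] then
    \int[mu]_x (ln (fine (Radon_Nikodym (charge_of_finite_measure mu) nu x)))%:E
  else +oo.

Definition is_coupling d1 d2 (T1 : measurableType d1) (T2 : measurableType d2)
    (R : realType) (mu0 : probability T1 R) (mu1 : probability T2 R)
    (g : probability (T1 * T2)%type R) : Prop :=
  (forall A, measurable A -> g (A `*` setT) = mu0 A) /\
  (forall B, measurable B -> g (setT `*` B) = mu1 B).

Section transport.
Context {R : realType} (d : nat).
Local Notation Rd := ('rV[R]_d).

(* Wasserstein distance on R^2d *)
Definition W2 (g g' : probability (Rd * Rd)%type R) : \bar R :=
  (ereal_inf [set \int[p]_w (enorm2 (w.1 - w.2) ^+ 2)%:E | p in is_coupling g g'])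
    `^ (2^-1)%R.

Variables mu0 mu1 : probability Rd R.

Definition transport_cost (g : probability (Rd * Rd)%type R) : \bar R :=
  \int[g]_z (quad_cost z)%:E.

Definition eot_functional (eps : R) (g : probability (Rd * Rd)%type R) : \bar R :=
  transport_cost g + eps%:E * entropy (sigma_finite_prod (lebesgue_rV d) (lebesgue_rV d)) g.

Definition is_eot_plan (eps : R) (g : probability (Rd * Rd)%type R) : Prop :=
  is_coupling mu0 mu1 g /\
  forall g', is_coupling mu0 mu1 g' -> eot_functional eps g <= eot_functional eps g'.

Definition is_ot_plan (g : probability (Rd * Rd)%type R) : Prop :=
  is_coupling mu0 mu1 g /\
  forall g', is_coupling mu0 mu1 g' -> transport_cost g <= transport_cost g'.

(* T is an everywhere defined version of the gradient of a finite convex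
   function on R^d, which exists Lebesgue-almost everywhere.  The equality
   T = grad f is required Lebesgue-a.e. and not only mu0-a.e., so that a
   Lipschitz bound on T is a Lipschitz bound on grad f over the whole of R^d
   even when the support of mu0 is not. *)
Definition is_brenier_map (T : Rd -> Rd) : Prop :=
  [/\ measurable_fun setT T,
      forall B, measurable B -> pushforward mu0 T B = mu1 B,
      forall g, is_coupling mu0 mu1 g ->
        \int[mu0]_x (quad_cost (x, T x))%:E <= transport_cost g &
      exists2 f : Rd -> R^o, convex_function [set: convex_lmodType Rd] f &
        {ae lebesgue_rV d, forall x, is_gradient f x (T x)}].

End transport.

Definition is_Theta (R : realType) (f : R -> \bar R) : Prop :=
  exists a b : R, [/\ (0 < a)%R, (a <= b)%R &
    \forall eps \near 0%R^'+, (a * eps)%:E <= f eps <= (b * eps)%:E].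

(* Main.v *)
From HB Require Import structures.
Require Import Defs.
From mathcomp Require Import all_boot all_order all_algebra.
From mathcomp Require Import all_classical all_reals all_analysis measurable_realfun.
From mathcomp Require Import ring lra.

Import Order.TTheory GRing.Theory Num.Theory.
Import numFieldNormedType.Exports.
Local Open Scope classical_set_scope.
Local Open Scope ring_scope.
Local Open Scope ereal_scope.

Set Implicit Arguments.
Unset Strict Implicit.
Unset Printing Implicit Defensive.

(** Let [C] stand for constants which depend only on the dimension [d], on the
    second moments of the marginals (controlled by those of order [2 + delta])
    and on their entropies. Write [g_eps] and [g_0] for the entropic and optimal
    plans and [H] for the entropy. Two estimates of [H] carry the proof; in both,
    the factor [d] appears because an optimal plan is a [d]-dimensional object in
    a space of dimension [2 * d].

    Upper estimate ([block_approximation]). Cut the space of the sums [x + y] into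
    cubes of side [r] and make the two coordinates of a plan independent
    conditionally on the cube. The marginals are kept; since
    [4 a.b <= |a + b|^2], the cost increases by at most [d r^2 / 8]; and the
    entropy of the new plan is at most [h0 + h1] plus the entropy of the
    partition, that is at most [d ln (1 / r) + C] ([fiber_entropy_le]). For
    [r = sqrt eps], minimality of [g_eps] gives
    [cost g_eps + eps H(g_eps) <= cost g_0 + eps (d ln (1 / sqrt eps) + C)].

    Lower estimate ([entropy_near_monotone_ge]). Optimality makes [g_0] monotone
    ([ot_plan_monotone]), so that in Minty's coordinates [(x + y, x)] it is carried
    by the graph of a nonexpansive map. A plan at distance at most [s] from [g_0]
    is, on average, within [C s] of this graph. Comparing it with a Gaussian
    thickening of the graph of width [s] by the Gibbs inequality ([gibbs]) shows
    that its entropy is at least [- d ln s - C].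

    Together ([eot_suboptimality_le]) they give
    [cost g_eps - cost g_0 <= eps (C + d ln (s / sqrt eps))] as soon as [s] bounds
    the distance from [g_eps] to [g_0]. The left-hand side is nonnegative, hence
    [s / sqrt eps] is bounded below: this is the lower bound of the theorem
    ([sqr_W2_lower]). If the Brenier map [T] is [L]-Lipschitz, the duality gap
    detaches quadratically, so that the integral [s^2] of [|y - T x|^2] against
    [g_eps] is at most [4 L (cost g_eps - cost g_0)] ([detachment]); as [g_0] is
    carried by the graph of [T], [s] also bounds the distance
    ([graph_coupling]). Then [s^2 / (4 L) <= eps (C + d ln (s / sqrt eps))], and a
    logarithm cannot compensate a linear growth: [s^2] is at most a multiple of
    [eps] ([sqr_W2_upper]).

    The competitors used for minimality are all obtained by exchanging the second
    coordinates of a pair of points of [R^d * R^d] whose law is invariant under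
    the exchange of the two points ([recoupling]). *)

(** * Integrals, images and reweighting of probabilities *)

(** The positive and negative parts are monotone, and subtraction of extended
    reals is monotone even when both terms are infinite. *)
Lemma ae_le_integral d (T : measurableType d) (R : realType)
    (mu : {measure set T -> \bar R}) (f g : T -> \bar R) :
  measurable_fun setT f -> measurable_fun setT g ->
  {ae mu, forall x, f x <= g x} -> \int[mu]_x f x <= \int[mu]_x g x.
Proof.
move=> mf mg fg; rewrite integralE [leRHS]integralE; apply: leeB.
  apply: ae_ge0_le_integral => //; [exact: measurable_funepos..|].
  apply: filterS fg => x fgx _; rewrite !funeposE.
  by rewrite ge_max !le_max fgx lexx orbT.
apply: ae_ge0_le_integral => //; [exact: measurable_funeneg..|].
apply: filterS fg => x fgx _; rewrite !funenegE.
by rewrite ge_max !le_max leeN2 fgx lexx orbT.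
Qed.

Lemma measurable_inv_ge0 d (T : measurableType d) (R : realType) (f : T -> R) :
  measurable_fun setT f -> (forall x, (0 <= f x)%R) ->
  measurable_fun setT (fun x => (f x)^-1)%R.
Proof.
move=> mf f0; rewrite (_ : (fun x => _) = (@powR R ^~ (-1)%R) \o f).
  by apply: measurableT_comp => //; exact: measurable_powR.
by apply/funext => x /=; rewrite powR_inv1.
Qed.

Lemma integral_probability_cst d (T : measurableType d) (R : realType)
    (P : probability T R) (r : \bar R) : \int[P]_x cst r x = r.
Proof. by rewrite integral_cst//= probability_setT mule1. Qed.

Section image_and_reweighting.
Context d1 d2 (X : measurableType d1) (Y : measurableType d2) (R : realType).

Lemma probability_image (P : probability X R) (phi : X -> Y) :
  measurable_fun setT phi ->
  exists Q : probability Y R,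
    (forall A, Q A = P (phi @^-1` A)) /\
    (forall f : Y -> \bar R, measurable_fun setT f ->
      \int[Q]_y f y = \int[P]_x f (phi x)).
Proof.
move=> mphi.
pose phi' : {mfun X >-> Y} := HB.pack phi (isMeasurableFun.Build _ _ _ _ _ mphi).
exists (distribution P phi'); split=> // f mf; rewrite integralE [RHS]integralE.
congr (_ - _).
- rewrite ge0_integral_distribution//; last exact: measurable_funepos.
  by apply: eq_integral => x _; rewrite /= !funeposE.
- rewrite ge0_integral_distribution//; last exact: measurable_funeneg.
  by apply: eq_integral => x _; rewrite /= !funenegE.
Qed.

Section reweight.
Variables (P : probability X R) (k : X -> R).
Hypotheses (mk : measurable_fun setT k) (k0 : forall x, (0 <= k x)%R).
Hypothesis k1 : \int[P]_x (k x)%:E = 1.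

Let Q (A : set X) : \bar R := \int[P]_(x in A) (k x)%:E.

Let Q0 : Q set0 = 0.
Proof. by rewrite /Q integral_set0. Qed.

Let Q_ge0 A : 0 <= Q A.
Proof. by apply: integral_ge0 => x _; rewrite lee_fin. Qed.

Let Q_sigma_additive : semi_sigma_additive Q.
Proof.
by apply: semi_sigma_additive_nng_induced => //; exact/measurable_EFinP.
Qed.

HB.instance Definition _ := isMeasure.Build _ _ _ Q Q0 Q_ge0 Q_sigma_additive.

Let QT : Q setT = 1. Proof. exact: k1. Qed.

HB.instance Definition _ := Measure_isProbability.Build _ _ _ Q QT.

(** The second formula follows from the first: the derivative of [Q] with
    respect to [P] is almost everywhere [k]. *)
Lemma probability_reweight : exists Q : probability X R,
  (forall A, measurable A -> Q A = \int[P]_(x in A) (k x)%:E) /\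
  (forall f : X -> \bar R, measurable_fun setT f -> (forall x, 0 <= f x) ->
      \int[Q]_x f x = \int[P]_x (f x * (k x)%:E)).
Proof.
exists Q; split=> // f mf f0.
have domQ : Q `<< P.
  apply/null_content_dominatesP => A mA PA.
  by apply: null_set_integral => //; exact/measurable_funTS/measurable_EFinP.
have := Radon_Nikodym_SigmaFinite.change_of_variables domQ f0 measurableT mf.
move=> <-.
have Ri := Radon_Nikodym_SigmaFinite.f_integrable domQ.
apply: ge0_ae_eq_integral => //.
- by apply: emeasurable_funM => //; exact: measurable_int Ri.
- by apply: emeasurable_funM => //; exact/measurable_EFinP.
- by move=> x _; rewrite mule_ge0// Radon_Nikodym_SigmaFinite.f_ge0.
- by move=> x _; rewrite mule_ge0// lee_fin.
apply: ae_eqe_mul2l; apply: integral_ae_eq => //; first exact/measurable_EFinP.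
by move=> E _ mE; rewrite -Radon_Nikodym_SigmaFinite.f_integral.
Qed.
End reweight.
End image_and_reweighting.

(** * Densities and the Gibbs inequality *)

Lemma null_dominates_ae d (T : measurableType d) (R : realType)
    (m1 m2 : {measure set T -> \bar R}) (P : T -> Prop) :
  m1 `<< m2 -> {ae m2, forall x, P x} -> {ae m1, forall x, P x}.
Proof.
by move=> /null_content_dominatesP m12 [N [mN N0 PN]]; exists N; split; rewrite ?m12.
Qed.

Section density.
Context d (T : measurableType d) (R : realType).
Variable nu : {sigma_finite_measure set T -> \bar R}.

(** This version of the derivative is nonnegative at every point, while the one
    in [entropy] is nonnegative almost everywhere; both give the same entropy
    ([entropyE]). *)
Definition density (mu : probability T R) (x : T) : R :=
  fine (Radon_Nikodym_SigmaFinite.f mu nu x).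

Variable mu : probability T R.
Hypothesis munu : mu `<< nu.

Let densityE x : (density mu x)%:E = Radon_Nikodym_SigmaFinite.f mu nu x.
Proof. by rewrite fineK// Radon_Nikodym_SigmaFinite.f_fin_num. Qed.

Lemma density_ge0 x : (0 <= density mu x)%R.
Proof. by rewrite -lee_fin densityE Radon_Nikodym_SigmaFinite.f_ge0. Qed.

Lemma measurable_density : measurable_fun setT (density mu).
Proof.
apply/measurable_EFinP; rewrite [X in measurable_fun _ X](_ : _ =
  Radon_Nikodym_SigmaFinite.f mu nu); last exact/funext/densityE.
exact: measurable_int (Radon_Nikodym_SigmaFinite.f_integrable munu).
Qed.

Lemma ge0_integral_density (f : T -> \bar R) : measurable_fun setT f ->
  (forall x, 0 <= f x) ->
  \int[mu]_x f x = \int[nu]_x (f x * (density mu x)%:E).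
Proof.
move=> mf f0.
rewrite -(Radon_Nikodym_SigmaFinite.change_of_variables munu f0)//.
by apply: eq_integral => x _; rewrite densityE.
Qed.

Lemma density_gt0 : {ae mu, forall x, (0 < density mu x)%R}.
Proof.
have md := measurable_density.
have m0 : measurable [set x | density mu x = 0%R].
  by rewrite -[X in measurable X]setTI; exact: (md measurableT _ (measurable_set1 _)).
exists [set x | density mu x = 0%R]; split => //.
  rewrite (Radon_Nikodym_SigmaFinite.f_integral munu)// integral0_eq// => x /=.
  by rewrite -densityE => ->.
by move=> x /= /negP; rewrite -leNgt => ?; apply/le_anti; rewrite density_ge0 andbT.
Qed.

(** Integrating a quotient against its denominator forgets the region where
    the denominator vanishes, hence an inequality. *)
Lemma integral_div_density_le (q : T -> R) : measurable_fun setT q ->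
  (forall x, (0 <= q x)%R) ->
  \int[mu]_x (q x / density mu x)%:E <= \int[nu]_x (q x)%:E.
Proof.
move=> mq q0; have md := measurable_density.
have mr : measurable_fun setT (fun x => q x / density mu x)%R.
  by apply: measurable_funM => //; apply: measurable_inv_ge0 => //; exact: density_ge0.
rewrite ge0_integral_density; last 2 first.
- exact/measurable_EFinP.
- by move=> x; rewrite lee_fin divr_ge0// density_ge0.
apply: ge0_le_integral => //=.
- by move=> x _; rewrite -EFinM lee_fin mulr_ge0 ?divr_ge0 ?density_ge0.
- by apply/measurable_EFinP; exact: measurable_funM.
- exact/measurable_EFinP.
move=> x _; rewrite -EFinM lee_fin.
by have [->|d0] := eqVneq (density mu x) 0%R; [rewrite mulr0|rewrite divfK].
Qed.

Lemma entropyE : entropy nu mu = \int[mu]_x (ln (density mu x))%:E.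
Proof.
rewrite /entropy asboolT//; apply: ae_eq_integral => //.
- apply/measurable_EFinP/measurableT_comp => //.
  by apply: measurableT_comp => //; exact: measurable_int (Radon_Nikodym_integrable _).
- by apply/measurable_EFinP/measurableT_comp => //; exact: measurable_density.
have := ae_eq_Radon_Nikodym_SigmaFinite munu measurableT.
move/(null_dominates_ae_eq measurableT munu).
by apply: filterS => x + _ => <-.
Qed.

(** The relative entropy with respect to a sub-probability density [q] is
    nonnegative: integrate [ln t <= t - 1] at [t = q / density]. *)
Lemma gibbs (q : T -> R) : measurable_fun setT q -> (forall x, (0 < q x)%R) ->
  \int[nu]_x (q x)%:E <= 1 -> mu.-integrable setT (fun x => (ln (q x))%:E) ->
  \int[mu]_x (ln (q x))%:E <= entropy nu mu.
Proof.
move=> mq q0 q1 iq; rewrite entropyE.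
have md := measurable_density.
have mr : measurable_fun setT (fun x => q x / density mu x)%R.
  by apply: measurable_funM => //; apply: measurable_inv_ge0 => //; exact: density_ge0.
have qd1 : \int[mu]_x (q x / density mu x)%:E <= 1.
  by apply: le_trans q1; apply: integral_div_density_le => // x; exact/ltW.
have r0 x : (0 <= q x / density mu x)%R by rewrite divr_ge0 ?density_ge0 ?ltW.
have ir : mu.-integrable setT (fun x => (q x / density mu x)%:E).
  apply/integrableP; split; first exact/measurable_EFinP.
  under eq_integral => x _ do rewrite gee0_abs ?lee_fin//.
  exact: le_lt_trans qd1 (ltry _).
have i1 : mu.-integrable setT (cst 1%:E) by exact: finite_measure_integrable_cst.
pose g (x : T) : \bar R := ((ln (q x))%:E + (1%:E - (q x / density mu x)%:E)).
apply: (@le_trans _ _ (\int[mu]_x g x)).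
  rewrite integralD//; last exact: integrableB.
  rewrite integralB// integral_probability_cst.
  by rewrite leeDl// sube_ge0// orbT.
apply: ae_le_integral.
- apply: emeasurable_funD; first exact: measurable_int iq.
  by apply: emeasurable_funB => //; exact: measurable_int ir.
- by apply/measurable_EFinP/measurableT_comp.
apply: filterS density_gt0 => x d0.
rewrite /g -!EFinB -EFinD lee_fin.
have : (ln (q x / density mu x) <= q x / density mu x - 1)%R.
  have t1 : (-1 < q x / density mu x - 1)%R by rewrite ltrBDr addNr divr_gt0.
  by have := le_ln1Dx t1; rewrite [(1 + _)%R]addrC subrK.
rewrite lnM ?posrE ?invr_gt0// lnV ?posrE//; lra.
Qed.

End density.

(** * The Euclidean inner product and Lebesgue measure *)

Section edot.
Local Open Scope ring_scope.
Context {R : realType} {d : nat}.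
Implicit Types x y z : 'rV[R]_d.

Lemma edotC x y : edot x y = edot y x.
Proof. by apply: eq_bigr => i _; rewrite mulrC. Qed.

Lemma edotDl x y z : edot (x + y) z = edot x z + edot y z.
Proof. by rewrite -big_split/=; apply: eq_bigr => i _; rewrite mxE mulrDl. Qed.

Lemma edotDr x y z : edot z (x + y) = edot z x + edot z y.
Proof. by rewrite edotC edotDl !(edotC z). Qed.

Lemma edotZl c x y : edot (c *: x) y = c * edot x y.
Proof. by rewrite mulr_sumr; apply: eq_bigr => i _; rewrite mxE mulrA. Qed.

Lemma edotZr c x y : edot y (c *: x) = c * edot y x.
Proof. by rewrite edotC edotZl edotC. Qed.

Lemma edotNl x y : edot (- x) y = - edot x y.
Proof. by rewrite -scaleN1r edotZl mulN1r. Qed.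

Lemma edotNr x y : edot y (- x) = - edot y x.
Proof. by rewrite edotC edotNl edotC. Qed.

Definition edotE := (edotDl, edotDr, edotNl, edotNr, edotZl, edotZr).

Lemma edot_ge0 x : 0 <= edot x x.
Proof. by apply: sumr_ge0 => i _; rewrite -expr2 sqr_ge0. Qed.

Lemma sqr_enorm x : enorm x ^+ 2 = edot x x.
Proof. by rewrite sqr_sqrtr// edot_ge0. Qed.

Lemma sqr_enorm2 (z : 'rV[R]_d * 'rV[R]_d) :
  enorm2 z ^+ 2 = edot z.1 z.1 + edot z.2 z.2.
Proof. by rewrite sqr_sqrtr ?sqr_enorm// addr_ge0 ?edot_ge0. Qed.

Lemma quad_costE (z : 'rV[R]_d * 'rV[R]_d) :
  quad_cost z = 2^-1 * edot (z.1 - z.2) (z.1 - z.2).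
Proof. by rewrite /quad_cost sqr_enorm. Qed.

Lemma quad_cost_ge0 (z : 'rV[R]_d * 'rV[R]_d) : 0 <= quad_cost z.
Proof. by rewrite quad_costE mulr_ge0// edot_ge0. Qed.

Lemma edot_add_le x y : edot (x + y) (x + y) <= 2 * edot x x + 2 * edot y y.
Proof. by have := edot_ge0 (x - y); rewrite !edotE (edotC y x); lra. Qed.

(** Young inequality with parameter [c]. *)
Lemma edot_le_young c x y : 0 < c ->
  2 * edot x y <= c^-1 * edot x x + c * edot y y.
Proof.
move=> c0; have := edot_ge0 (x - c *: y).
rewrite !edotE (edotC y x) => h.
have : 0 <= c^-1 * (edot x x - c * edot x y - (c * edot x y - c * (c * edot y y))).
  rewrite mulr_ge0 ?invr_ge0 ?(ltW c0)//; lra.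
rewrite !mulrBr !mulrA mulVf ?gt_eqF// !mul1r; lra.
Qed.

(** This is what makes the block approximation cheap in the direction of
    [x + y]. *)
Lemma edot_mul4_le x y : 4 * edot x y <= edot (x + y) (x + y).
Proof. by have := edot_ge0 (x - y); rewrite !edotE (edotC y x); lra. Qed.

(** For a monotone pair of increments, the increment of the sum controls each of
    them: this is the nonexpansiveness in Minty's parametrization. *)
Lemma edot_le_add x y : 0 <= edot x y -> edot x x <= edot (x + y) (x + y).
Proof. by have := edot_ge0 y; rewrite !edotE (edotC y x); lra. Qed.

End edot.

Section measurable_rV.
Context {R : realType} {n : nat} d (T : measurableType d).
Implicit Types f g : T -> 'rV[R]_n.

Lemma measurable_coord f (i : 'I_n) : measurable_fun setT f ->
  measurable_fun setT (fun x => f x ord0 i : R).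
Proof. by move=> /measurable_fun_rVP /(_ i). Qed.

Lemma measurable_rVD f g : measurable_fun setT f -> measurable_fun setT g ->
  measurable_fun setT (fun x => f x + g x)%R.
Proof.
move=> mf mg; apply/measurable_fun_rVP => i.
rewrite (_ : _ \o _ = fun x => f x ord0 i + g x ord0 i)%R.
  by apply: measurable_funD; exact: measurable_coord.
by apply/funext => x /=; rewrite /rV_coord mxE.
Qed.

Lemma measurable_rVN f : measurable_fun setT f ->
  measurable_fun setT (fun x => - f x)%R.
Proof.
move=> mf; apply/measurable_fun_rVP => i.
rewrite (_ : _ \o _ = fun x => - f x ord0 i)%R.
  by apply: measurableT_comp => //; exact: measurable_coord.
by apply/funext => x /=; rewrite /rV_coord mxE.
Qed.

Lemma measurable_rVB f g : measurable_fun setT f -> measurable_fun setT g ->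
  measurable_fun setT (fun x => f x - g x)%R.
Proof. by move=> mf mg; apply: measurable_rVD => //; exact: measurable_rVN. Qed.

Lemma measurable_edot f g : measurable_fun setT f -> measurable_fun setT g ->
  measurable_fun setT (fun x => edot (f x) (g x)).
Proof.
move=> mf mg; apply: measurable_sum => i.
by apply: measurable_funM; exact: measurable_coord.
Qed.

End measurable_rV.

Section lebesgue_rV_integral.
Context {R : realType}.

Lemma integral_lebesgue_rVS n (f : 'rV[R]_n.+1 -> \bar R) :
  measurable_fun setT f -> (forall x, 0 <= f x) ->
  \int[lebesgue_rV n.+1]_x f x =
  \int[lebesgue_measure]_a \int[lebesgue_rV n]_v f (rV_cons (a, v)).
Proof.
move=> mf f0.
have mc := @measurable_rV_cons R n.
transitivity (\int[sigma_finite_prod (@lebesgue_measure R) (lebesgue_rV n)]_z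
    f (rV_cons z)).
  by rewrite -(ge0_integral_pushforward mc _ _ mf).
rewrite -(fubini_tonelli1 (fun z => f (rV_cons z)))//.
exact: measurableT_comp.
Qed.

Lemma integral_lebesgue_rV0 (f : 'rV[R]_0 -> \bar R) : measurable_fun setT f ->
  \int[lebesgue_rV 0]_x f x = f 0%R.
Proof. by move=> mf; rewrite /= integral_dirac// diracT mul1e. Qed.

Lemma ge0_integral_lebesgue_measureD (c : R) (f : R -> \bar R) :
  measurable_fun setT f -> (forall x, 0 <= f x) ->
  \int[lebesgue_measure]_x f (x + c)%R = \int[lebesgue_measure]_x f x.
Proof.
move=> mf f0.
pose mR := measurableTypeR R.
have mc : measurable_fun [set: mR] ((fun x => x + c)%R : mR -> mR).
  exact: measurable_funD.
pose shift : {mfun mR >-> mR} := HB.pack (fun x : mR => x + c : mR)%R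
  (isMeasurableFun.Build _ _ _ _ _ mc).
rewrite -(ge0_integral_pushforward mc _ _ mf)//.
apply: eq_measure_integral => A mA _.
suff H : forall A, measurable A ->
  lebesgue_measure A = pushforward lebesgue_measure shift A.
  by first [exact: H|exact/esym/H].
move=> {A mA}.
apply: lebesgue_measure_unique => _ [[a b]] _ <-.
have shiftE : shift @^-1` `]a, b]%classic = `]a - c, b - c]%classic%R.
  by apply/seteqP; split => x /=; rewrite !in_itv/=; lra.
rewrite [RHS](_ : _ = lebesgue_measure (shift @^-1` `]a, b]%classic))// shiftE.
rewrite !lebesgue_measure_itv/= !lte_fin ltrD2r; case: ifP => // _.
by rewrite -!EFinB; congr EFin; ring.
Qed.

Lemma rV_consD n (a b : R) (v w : 'rV[R]_n) :
  (rV_cons (a, v) + rV_cons (b, w) = rV_cons (a + b, v + w))%R.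
Proof.
apply/rowP => i; rewrite mxE; case: (unliftP ord0 i) => [j ->|->].
  by rewrite !rV_consS mxE.
by rewrite !rV_cons0.
Qed.

Lemma rV_unconsK n : cancel (@rV_uncons R n) (@rV_cons R n).
Proof.
move=> x; apply/rowP => i; case: (unliftP ord0 i) => [j ->|->].
  by rewrite rV_consS mxE.
by rewrite rV_cons0.
Qed.

(** Translation invariance is inherited coordinate by coordinate from the line. *)
Lemma ge0_integral_lebesgue_rVD n (c : 'rV[R]_n) (f : 'rV[R]_n -> \bar R) :
  measurable_fun setT f -> (forall x, 0 <= f x) ->
  \int[lebesgue_rV n]_x f (x + c)%R = \int[lebesgue_rV n]_x f x.
Proof.
elim: n c f => [|n IH] c f mf f0.
  rewrite !integral_lebesgue_rV0//; first by congr f; apply/rowP; case.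
  apply: measurableT_comp => //.
  by apply: measurable_rVD; [exact: measurable_id|exact: measurable_cst].
rewrite !integral_lebesgue_rVS//; last first.
  apply: measurableT_comp => //.
  by apply: measurable_rVD; [exact: measurable_id|exact: measurable_cst].
rewrite -(rV_unconsK c); case: (rV_uncons c) => b w.
have mfc : measurable_fun setT (f \o @rV_cons R n).
  by apply: measurableT_comp => //; exact: measurable_rV_cons.
rewrite -(ge0_integral_lebesgue_measureD b
    (f := fun a => \int[lebesgue_rV n]_v f (rV_cons (a, v)))); last 2 first.
- by apply: (measurable_fun_fubini_tonelli_F (f \o @rV_cons R n)) => // x; exact: f0.
- by move=> x; exact: integral_ge0.
apply: eq_integral => a _; under eq_integral do rewrite rV_consD.
apply: (IH w (fun v => f (rV_cons ((a + b)%R, v)))) => //.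
by have := measurableT_comp mfc (@pair1_measurable _ _ _ _ (a + b)%R).
Qed.

(** * Gaussian densities *)

Definition gaussian n (m : 'rV[R]_n) (s : R) (x : 'rV[R]_n) : R :=
  (\prod_(i < n) normal_pdf (m ord0 i) s (x ord0 i))%R.

Lemma gaussian_ge0 n (m : 'rV[R]_n) s x : (0 <= gaussian m s x)%R.
Proof. by apply: prodr_ge0 => i _; exact: normal_pdf_ge0. Qed.

Lemma gaussianE n (m : 'rV[R]_n) s x : (0 < s)%R ->
  gaussian m s x = (Num.sqrt (2 * pi * s ^+ 2) ^- n *
    expR (- edot (x - m) (x - m) / (2 * s ^+ 2)))%R.
Proof.
move=> s0; rewrite /gaussian.
under eq_bigr do rewrite normal_pdfE ?gt_eqF//.
rewrite big_split/= prodr_const card_ord; congr (_ * _)%R.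
  by rewrite exprVn /normal_peak; congr (Num.sqrt _ ^- _)%R; ring.
rewrite -expR_sum; congr expR.
rewrite /edot mulNr mulr_suml -sumrN; apply: eq_bigr => i _.
by rewrite !mxE mulNr -mulr_natl -expr2.
Qed.

Lemma measurable_gaussian n d (T : measurableType d) (m x : T -> 'rV[R]_n) s :
  (0 < s)%R -> measurable_fun setT m -> measurable_fun setT x ->
  measurable_fun setT (fun t => gaussian (m t) s (x t)).
Proof.
move=> s0 mm mx.
rewrite (_ : (fun t => _) = (fun t => Num.sqrt (2 * pi * s ^+ 2) ^- n *
    expR (- edot (x t - m t) (x t - m t) / (2 * s ^+ 2))))%R; last first.
  by apply/funext => t; rewrite gaussianE.
apply: measurable_funM => //; apply: measurableT_comp => //.
apply: measurable_funM => //; apply: measurableT_comp => //.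
by apply: measurable_edot; exact: measurable_rVB.
Qed.

Lemma integral_gaussian n (m : 'rV[R]_n) s : (0 < s)%R ->
  \int[lebesgue_rV n]_x (gaussian m s x)%:E = 1.
Proof.
move=> s0; elim: n m => [|n IH] m.
  rewrite integral_lebesgue_rV0; first by rewrite /gaussian big_ord0.
  by apply/measurable_EFinP/measurable_gaussian.
rewrite integral_lebesgue_rVS; last 2 first.
- by apply/measurable_EFinP/measurable_gaussian.
- by move=> x; rewrite lee_fin gaussian_ge0.
rewrite -(rV_unconsK m); case: (rV_uncons m) => b w.
rewrite -[RHS](@integral_normal_pdf _ b s).
apply: eq_integral => a _.
transitivity (\int[lebesgue_rV n]_v ((normal_pdf b s a)%:E * (gaussian w s v)%:E)).
  apply: eq_integral => v _; rewrite -EFinM /gaussian big_ord_recl !rV_cons0.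
  by congr (_ * _)%:E; apply: eq_bigr => i _; rewrite !rV_consS.
rewrite ge0_integralZl_EFin//.
- by rewrite IH mule1.
- by move=> x _; rewrite lee_fin gaussian_ge0.
- by apply/measurable_EFinP/measurable_gaussian.
- exact: normal_pdf_ge0.
Qed.

End lebesgue_rV_integral.

(** * Partition of the space into cubes *)

Section countable_index.
Context d (T : measurableType d) (I : countType) (K : T -> I).
Hypothesis mK : forall k, measurable (K @^-1` [set k]).

Lemma measurable_fun_countable d' (U : measurableType d') (h : I -> U) :
  measurable_fun setT (h \o K).
Proof.
move=> _ A mA; rewrite setTI.
rewrite (_ : _ @^-1` _ =
    \bigcup_k (if `[< A (h k) >] then K @^-1` [set k] else set0)).
  by apply: countable_bigcupT_measurable => // k; case: ifP.
apply/seteqP; split => [t At|t [k _]].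
  by exists (K t) => //; rewrite asboolT.
by case: ifPn => // /asboolP Ak /= ->.
Qed.

Lemma measurable_countable_pred (P : pred I) : measurable [set t | P (K t)].
Proof.
have /(_ measurableT [set true]) := @measurable_fun_countable _ _ P.
by rewrite setTI; apply.
Qed.

(** The union of the null fibres is a countable union. *)
Lemma ae_fiber_gt0 (R : realType) (g : probability T R) :
  {ae g, forall t, (0 < fine (g (K @^-1` [set K t])))%R}.
Proof.
pose p k := fine (g (K @^-1` [set k])).
pose N := \bigcup_k (if p k == 0%R then K @^-1` [set k] else set0).
have mN : measurable N.
  by apply: countable_bigcupT_measurable => // k; case: ifP.
exists N; split => //; last first.
  move=> t /= /negP; rewrite -leNgt => pt; exists (K t) => //.
  by rewrite ifT// eq_le pt fine_ge0.
apply/eqP; rewrite eq_le measure_ge0 andbT.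
pose F n := if unpickle n is Some k then
  (if p k == 0%R then K @^-1` [set k] else set0) else set0.
have mF n : measurable (F n).
  by rewrite /F; case: unpickle => // k; case: ifP.
have F0 n : g (F n) = 0.
  rewrite /F; case: unpickle => [k|]; last by rewrite measure0.
  case: ifPn => [/eqP pk0|_]; last by rewrite measure0.
  by rewrite -[LHS]fineK ?fin_num_measure// -/(p k) pk0.
have -> : N = \bigcup_n F n.
  apply/seteqP; split => t [k _ Ft]; first by exists (pickle k); rewrite /F ?pickleK.
  by move: Ft; rewrite /F; case: unpickle => // j Ft; exists j.
apply: (@le_trans _ _ (\sum_(n <oo) g (F n))).
  by apply: measure_sigma_subadditive => //; exact: bigcupT_measurable.
by rewrite eseries0// => n _ _; rewrite F0.
Qed.

End countable_index.

Section cells.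
Context {R : realType} (d : nat).
Local Notation Rd := ('rV[R]_d).

Definition cell_index (r : R) (x : Rd) : 'rV[int]_d :=
  (\row_i Num.floor (x ord0 i / r))%R.

Lemma cell_indexE r (k : 'rV[int]_d) : (0 < r)%R ->
  cell_index r @^-1` [set k] = [set x | forall i,
    `[r * (k ord0 i)%:~R, r * (k ord0 i)%:~R + r[%classic (rV_coord i x)]%R.
Proof.
move=> r0.
have H (x : Rd) (j : 'rV[int]_d) i : (Num.floor (x ord0 i / r) == j ord0 i)%R =
    (x ord0 i \in `[r * (j ord0 i)%:~R, r * (j ord0 i)%:~R + r[)%R.
  rewrite floor_eq in_itv/= ler_pdivlMr// ltr_pdivrMr// intrD mulrDl mul1r.
  by rewrite mulrC.
apply/seteqP; split => [x <- i|x /= Hx].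
  by have := H x (cell_index r x) i; rewrite [in LHS]mxE eqxx => /esym.
by apply/rowP => i; rewrite mxE; apply/eqP; rewrite H; exact: Hx.
Qed.

Lemma measurable_cell r k : (0 < r)%R -> measurable (cell_index r @^-1` [set k]).
Proof.
move=> r0; rewrite cell_indexE// (_ : [set _ | _] =
    \bigcap_(i in [set: 'I_d]) (rV_coord i @^-1`
      `[r * (k ord0 i)%:~R, r * (k ord0 i)%:~R + r[%classic)%R).
  apply: fin_bigcap_measurable => // i _; rewrite -[X in measurable X]setTI.
  exact: measurable_rV_coord.
by apply/seteqP; split => x /= H i; [move=> _|]; exact: H.
Qed.

Lemma lebesgue_cell r k : (0 < r)%R ->
  lebesgue_rV d (cell_index r @^-1` [set k]) = (r ^+ d)%:E.
Proof.
move=> r0; rewrite cell_indexE//.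
rewrite (lebesgue_rV_box (A := fun i =>
  `[r * (k ord0 i)%:~R, r * (k ord0 i)%:~R + r[%classic)%R)//.
under eq_bigr => i _.
  rewrite lebesgue_measure_itv/= lte_fin ltrDl r0 -EFinB addrAC subrr add0r; over.
by rewrite prodEFin prodr_const card_ord.
Qed.

Lemma cell_diam r (x y : Rd) : (0 < r)%R -> cell_index r x = cell_index r y ->
  (edot (x - y) (x - y) <= d%:R * r ^+ 2)%R.
Proof.
move=> r0 xy; rewrite mulr_natl -[X in (_ *+ X)%R](card_ord d) -sumr_const.
apply: ler_sum => i _; rewrite !mxE.
have Hx : (cell_index r @^-1` [set cell_index r x]) x by [].
have Hy : (cell_index r @^-1` [set cell_index r x]) y by rewrite /= xy.
move: Hx Hy; rewrite cell_indexE// => /(_ i) + /(_ i).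
rewrite /= !in_itv/= /rV_coord; set c := (r * _)%R => /andP[h1 h2] /andP[h3 h4].
have ab : (`|x ord0 i - y ord0 i| <= `|r|)%R.
  by rewrite (gtr0_norm r0) ler_norml; lra.
rewrite -expr2 -[(_ ^+ 2)%R]real_normK ?num_real//.
by rewrite -[(r ^+ 2)%R]real_normK ?num_real// ler_sqr.
Qed.

End cells.

(** * Couplings and exchangeable pairs *)

Lemma integral_indicT d (T : measurableType d) (R : realType)
    (mu : {measure set T -> \bar R}) A : measurable A ->
  \int[mu]_z (\1_A z)%:E = mu A.
Proof. by move=> mA; rewrite integral_indic// setIT. Qed.

Section coupling.
Context d1 d2 (T1 : measurableType d1) (T2 : measurableType d2) (R : realType).
Variables (mu0 : probability T1 R) (mu1 : probability T2 R).
Variable g : probability (T1 * T2)%type R.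
Hypothesis cg : is_coupling mu0 mu1 g.

Lemma coupling_integral_fst (f : T1 -> \bar R) : measurable_fun setT f ->
  \int[g]_z f z.1 = \int[mu0]_x f x.
Proof.
move=> mf; have [Q [QE <-//]] := probability_image g (@measurable_fst _ _ T1 T2).
apply: eq_measure_integral => A mA _.
transitivity (g (A `*` setT)); last exact: cg.1.
by apply: etrans (QE A) _; congr (g _); apply/seteqP; split => z /=; [|case].
Qed.

Lemma coupling_integral_snd (f : T2 -> \bar R) : measurable_fun setT f ->
  \int[g]_z f z.2 = \int[mu1]_y f y.
Proof.
move=> mf; have [Q [QE <-//]] := probability_image g (@measurable_snd _ _ T1 T2).
apply: eq_measure_integral => A mA _.
transitivity (g (setT `*` A)); last exact: cg.2.
by apply: etrans (QE A) _; congr (g _); apply/seteqP; split => z /=; [|case].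
Qed.

Lemma coupling_ae_fst (P : T1 -> Prop) :
  {ae mu0, forall x, P x} -> {ae g, forall z, P z.1}.
Proof.
move=> [N [mN N0 PN]]; exists (N `*` setT); split.
- exact: measurableX.
- by rewrite (cg.1 _ mN).
- by move=> z Pz; split => //=; exact: PN.
Qed.

Lemma coupling_ae_snd (P : T2 -> Prop) :
  {ae mu1, forall x, P x} -> {ae g, forall z, P z.2}.
Proof.
move=> [N [mN N0 PN]]; exists (setT `*` N); split.
- exact: measurableX.
- by rewrite (cg.2 _ mN).
- by move=> z Pz; split => //=; exact: PN.
Qed.

Lemma coupling_integrable_fst (f : T1 -> \bar R) :
  mu0.-integrable setT f -> g.-integrable setT (fun z => f z.1).
Proof.
move=> /integrableP[mf fi]; apply/integrableP; split.
  exact: measurableT_comp.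
rewrite (coupling_integral_fst (f := fun x => `|f x|))//.
exact: measurableT_comp.
Qed.

Lemma coupling_integrable_snd (f : T2 -> \bar R) :
  mu1.-integrable setT f -> g.-integrable setT (fun z => f z.2).
Proof.
move=> /integrableP[mf fi]; apply/integrableP; split.
  exact: measurableT_comp.
rewrite (coupling_integral_snd (f := fun x => `|f x|))//.
exact: measurableT_comp.
Qed.

End coupling.

Section self_coupling.
Context d (Z : measurableType d) (R : realType).
Variable g : probability Z R.

Definition symmetric_measure (Q : probability (Z * Z)%type R) :=
  forall A, measurable A -> Q (swap_pair @^-1` A) = Q A.

Lemma measurable_swap_pair : measurable_fun setT (@swap_pair Z Z).
Proof. exact: measurable_fun_pair. Qed.

Lemma symmetric_measure_integral (Q : probability (Z * Z)%type R)
    (f : Z * Z -> \bar R) : symmetric_measure Q -> measurable_fun setT f ->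
  \int[Q]_z f (swap_pair z) = \int[Q]_z f z.
Proof.
move=> symQ mf; have [Q' [QE <-//]] := probability_image Q measurable_swap_pair.
by apply: eq_measure_integral => A mA _; apply: etrans (QE A) _; exact: symQ.
Qed.

Lemma symmetric_product : symmetric_measure (g \x g)%E.
Proof.
move=> A mA.
have mi B : measurable B -> measurable_fun setT (fun z : Z * Z => (\1_B z)%:E : \bar R).
  by move=> mB; exact/measurable_EFinP/measurable_indic.
have mS : measurable (swap_pair @^-1` A : set (Z * Z)).
  by rewrite -[X in measurable X]setTI; exact: measurable_swap_pair.
apply: etrans (esym (integral_indicT _ mS)) _.
apply: etrans _ (integral_indicT _ mA).
rewrite (fubini_tonelli1 (fun z => (\1_(swap_pair @^-1` A) z)%:E))//; last exact: mi.
rewrite (fubini_tonelli2 (fun z => (\1_A z)%:E))//; exact: mi.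
Qed.

Lemma self_coupling_product : is_coupling g g (g \x g)%E.
Proof.
split=> A mA; (apply: etrans; first exact: product_measure1E).
  by rewrite -[RHS]mule1 -(probability_setT g).
by rewrite -[RHS]mul1e -(probability_setT g).
Qed.

(** Two points are drawn from [g] independently conditionally on being in the
    same fibre of [K]: the law has density [(K z.1 == K z.2) / p z.1] with
    respect to [g \x g]. The last clause is the only quantitative information on
    this density which is used afterwards. *)
Lemma fiber_self_coupling (I : countType) (K : Z -> I)
    (p := fun z => fine (g (K @^-1` [set K z]))) :
  (forall k, measurable (K @^-1` [set k])) ->
  exists Q : probability (Z * Z)%type R,
  [/\ is_coupling g g Q, symmetric_measure Q,
      {ae Q, forall z, K z.1 = K z.2},
      Q `<< (g \x g)%E &
      forall f : Z * Z -> \bar R, measurable_fun setT f -> (forall z, 0 <= f z) ->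
        \int[Q]_z (f z * (p z.1)%:E) <= \int[(g \x g)%E]_z f z].
Proof.
move=> mK.
pose K2 (z : Z * Z) := (K z.1, K z.2).
have mK2 kl : measurable (K2 @^-1` [set kl]).
  have -> : K2 @^-1` [set kl] = (K @^-1` [set kl.1]) `*` (K @^-1` [set kl.2]).
    apply/seteqP; split => [z <-//|z [/= z1 z2]]; rewrite /K2 z1 z2.
    by case: kl {z1 z2}.
  exact: measurableX.
pose P k : R := fine (g (K @^-1` [set k])).
pose h (kl : I * I) : R := ((kl.1 == kl.2)%:R / P kl.1)%R.
pose k := h \o K2.
have mk : measurable_fun setT k by exact: measurable_fun_countable.
have P0 i : (0 <= P i)%R by exact: fine_ge0.
have k0 z : (0 <= k z)%R by rewrite /k/= divr_ge0.
have mp : measurable_fun setT (fun z : Z * Z => p z.1).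
  exact: (measurable_fun_countable mK2 (P \o fst)).
have ip z : \int[g]_y ((K z == K y)%:R)%:E = (p z)%:E.
  rewrite (_ : (fun y => _) = fun y => (\1_(K @^-1` [set K z]) y)%:E); last first.
    apply/funext => y; rewrite indicE; congr ((nat_of_bool _)%:R)%:E.
    by apply/eqP/idP => [->|/[!inE]]; rewrite ?inE.
  by rewrite integral_indic// setIT fineK ?fin_num_measure.
have p_gt0 := ae_fiber_gt0 mK g.
have mfk (f : Z * Z -> \bar R) : measurable_fun setT f ->
    measurable_fun setT (fun z => f z * (k z)%:E).
  by move=> mf; apply: emeasurable_funM => //; exact/measurable_EFinP.
have int1 (f : Z -> \bar R) : measurable_fun setT f -> (forall x, 0 <= f x) ->
    \int[(g \x g)%E]_z (f z.1 * (k z)%:E) = \int[g]_x f x.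
  move=> mf f0.
  have mf1 : measurable_fun setT (fun z : Z * Z => f z.1) by exact: measurableT_comp.
  rewrite (fubini_tonelli1 (fun z => f z.1 * (k z)%:E))//; first last.
  - by move=> z; rewrite mule_ge0// lee_fin.
  - exact: mfk.
  apply: ge0_ae_eq_integral => //.
  - apply: measurable_fun_fubini_tonelli_F; first exact: mfk.
    by move=> z; rewrite mule_ge0// lee_fin.
  - by move=> x _; apply: integral_ge0 => y _; rewrite mule_ge0// lee_fin.
  apply: filterS p_gt0 => x px _; rewrite /fubini_F/=.
  have mKx : measurable_fun setT (fun y => (K x == K y)%:R : R).
    exact: (measurable_fun_countable mK (fun i => (K x == i)%:R%R : R)).
  transitivity (\int[g]_y ((f x * ((p x)^-1)%:E) * ((K x == K y)%:R)%:E)).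
    by apply: eq_integral => y _; rewrite -muleA -EFinM mulrC.
  rewrite ge0_integralZl//.
  - by rewrite ip -muleA -EFinM mulVf ?mule1// gt_eqF.
  - exact/measurable_EFinP.
  - by rewrite mule_ge0// lee_fin invr_ge0 ltW.
have k1 : \int[(g \x g)%E]_z (k z)%:E = 1.
  have := int1 (cst 1) (measurable_cst _) (fun=> lee01).
  rewrite integral_probability_cst => <-.
  by apply: eq_integral => z _; rewrite mul1e.
have [Q [QE Qint]] := probability_reweight mk k0 k1.
have Qi A : measurable A -> Q A = \int[(g \x g)%E]_z ((\1_A z)%:E * (k z)%:E).
  move=> mA; rewrite -Qint//.
  - by apply/esym/integral_indicT.
  - exact/measurable_EFinP/measurable_indic.
have symQ : symmetric_measure Q.
  move=> A mA.
  have mS : measurable (swap_pair @^-1` A : set (Z * Z)).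
    by rewrite -[X in measurable X]setTI; exact: measurable_swap_pair.
  rewrite !Qi// -(symmetric_measure_integral symmetric_product
    (f := fun z => (\1_A z)%:E * (k z)%:E)); last first.
    by apply: mfk; exact/measurable_EFinP/measurable_indic.
  apply: eq_integral => -[x y] _; rewrite !indicE; congr (_ * _%:E).
  by rewrite /k/= /h/= eq_sym; case: eqP => [->|]//; rewrite !mul0r.
have Q1 A : measurable A -> Q (A `*` setT) = g A.
  move=> mA; rewrite Qi; last exact: measurableX.
  apply: etrans _ (integral_indicT _ mA); rewrite -int1//.
  - by apply: eq_integral => z _; rewrite !indicE in_setX in_setT andbT.
  - exact/measurable_EFinP/measurable_indic.
exists Q; split => //.
- split => // A mA; rewrite -Q1// -symQ; last exact: measurableX.
  by congr (Q _); apply/seteqP; split => -[x y] /= [].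
- have mN : measurable [set z : Z * Z | K z.1 != K z.2].
    exact: (measurable_countable_pred mK2 (fun kl => kl.1 != kl.2)).
  exists [set z | K z.1 != K z.2]; split => //; last by move=> z /= /eqP.
  rewrite Qi// integral0_eq// => z _; rewrite indicE /k /h/=.
  have [Kz|Kz] := eqVneq (K z.1) (K z.2); last by rewrite mul0r mule0.
  by rewrite memNset ?mul0e//= Kz eqxx.
- apply/null_content_dominatesP => A mA A0.
  rewrite QE//; apply: null_set_integral => //.
  exact/measurable_funTS/measurable_EFinP.
- move=> f mf f0; rewrite Qint; last 2 first.
  + by apply: emeasurable_funM => //; exact/measurable_EFinP.
  + by move=> z; rewrite mule_ge0// lee_fin fine_ge0.
  apply: ge0_le_integral => //.
  + by move=> z _; rewrite !mule_ge0// lee_fin ?fine_ge0.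
  + by apply: mfk; apply: emeasurable_funM => //; exact/measurable_EFinP.
  move=> z _; rewrite -muleA -[leRHS]mule1 lee_wpmul2l// -EFinM lee_fin.
  rewrite /k /h/= -/(P (K z.1)) /p -/(P (K z.1)).
  have [->|Pz] := eqVneq (P (K z.1)) 0%R; first by rewrite mul0r.
  by rewrite mulrCA divff// mulr1 lern1; case: eqP.
Qed.

End self_coupling.

Section recoupling.
Context d1 d2 (T1 : measurableType d1) (T2 : measurableType d2) (R : realType).
Local Notation Z := (T1 * T2)%type.
Variables (mu0 : probability T1 R) (mu1 : probability T2 R).
Variables (g : probability Z R) (Q : probability (Z * Z)%type R).
Hypotheses (cg : is_coupling mu0 mu1 g) (cQ : is_coupling g g Q).
Hypothesis symQ : symmetric_measure Q.
Variable b : Z * Z -> bool.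
Hypotheses (mb : measurable_fun setT b) (bC : forall z, b (swap_pair z) = b z).

(** On the event [b] the second coordinates of two exchangeable points are
    exchanged; since [b] is invariant under the exchange, the marginals do not
    change. *)
Lemma recoupling : exists g' : probability Z R, is_coupling mu0 mu1 g' /\
  forall f : Z -> \bar R, measurable_fun setT f ->
    \int[g']_z f z = \int[Q]_z f (z.1.1, if b z then z.2.2 else z.1.2).
Proof.
pose phi (z : Z * Z) : Z := (z.1.1, if b z then z.2.2 else z.1.2).
have mphi : measurable_fun setT phi.
  apply: measurable_fun_pair; first exact: measurableT_comp.
  by apply: measurable_fun_ifT => //; exact: measurableT_comp.
have [g' [gE gint]] := probability_image Q mphi.
exists g'; split; last exact: gint.
have mbT : measurable (b @^-1` [set true]).
  by rewrite -[X in measurable X]setTI; exact: mb.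
split=> A mA.
  transitivity (Q ((A `*` setT) `*` setT)).
    rewrite gE; congr (Q _); apply/seteqP.
    by split => -[[x y] [x' y']] /= [] // [].
  by rewrite cQ.1 ?cg.1//; exact: measurableX.
have mX : measurable (setT `*` A : set Z) by exact: measurableX.
have mY1 : measurable ((setT `*` A) `*` setT : set (Z * Z)) by exact: measurableX.
have mY2 : measurable (setT `*` (setT `*` A) : set (Z * Z)) by exact: measurableX.
have -> : g' (setT `*` A) = Q (((setT `*` A) `*` setT `\` b @^-1` [set true]) `|`
    ((setT `*` (setT `*` A)) `&` b @^-1` [set true])).
  rewrite gE; congr (Q _); apply/seteqP.
  split => -[[x y] [x' y']]; rewrite /phi/=.
    by case: (b _) => /= -[_ Ay]; [right|left].
  by move=> [[[[_ Ay] _] /negP/negbTE ->]|[[_ [_ Ay]] ->]].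
apply: (@etrans _ _ (Q ((setT `*` A) `*` setT))); last by rewrite cQ.1 ?cg.2.
apply: etrans; first apply: measureU.
- exact: measurableD.
- exact: measurableI.
- by apply/seteqP; split => // z /= [[_ ?] [_ ?]].
apply: etrans (esym (measureDI Q mY1 mbT)); congr (_ + _).
apply: etrans; first exact/esym/symQ/measurableI.
congr (Q _); apply/seteqP; split => -[[x y] [x' y']] /=.
  by move=> [[_ [_ Ay]]]; rewrite -[b _]bC.
by move=> [[[_ Ay] _]]; rewrite -[b _]bC.
Qed.

End recoupling.

(** * Exchanging partners and the monotonicity of optimal plans *)

Section costs.
Context {R : realType} (d : nat).
Local Notation Rd := ('rV[R]_d).
Local Notation Z := (Rd * Rd)%type.

Lemma measurable_quad_cost d' (T : measurableType d') (f : T -> Z) :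
  measurable_fun setT f -> measurable_fun setT (fun t => quad_cost (f t)).
Proof.
move=> mf; under eq_fun do rewrite quad_costE.
apply: measurable_funM => //.
by apply: measurable_edot; apply: measurable_rVB; exact: measurableT_comp.
Qed.

Lemma moment2_le (mu : probability Rd R) (delta m : R) : (0 < delta)%R ->
  moment (2 + delta) mu = m%:E -> \int[mu]_x (edot x x)%:E <= (1 + m)%:E.
Proof.
move=> delta0 mE.
have msq : measurable_fun setT (fun x : Rd => edot x x) by exact: measurable_edot.
have men : measurable_fun setT (@enorm R d).
  rewrite (_ : @enorm R d = (@powR R ^~ 2^-1) \o (fun x => edot x x))%R.
    by apply: measurableT_comp => //; exact: measurable_powR.
  by apply/funext => x /=; rewrite powR12_sqrt// edot_ge0.
have mpow : measurable_fun setT (fun x : Rd => (enorm x `^ (2 + delta))%R).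
  exact: (measurableT_comp (measurable_powR (2 + delta)%R) men).
rewrite EFinD -mE /moment -[1%:E](integral_probability_cst mu).
rewrite -ge0_integralD//; last 2 first.
- by move=> x _; rewrite lee_fin powR_ge0.
- exact/measurable_EFinP.
apply: ge0_le_integral => //.
- by move=> x _; rewrite lee_fin edot_ge0.
- exact/measurable_EFinP.
- by apply: emeasurable_funD => //; exact/measurable_EFinP.
move=> x _; rewrite -EFinD lee_fin -sqr_enorm.
have en0 : (0 <= enorm x)%R by exact: sqrtr_ge0.
have [n1|n1] := leP (enorm x) 1%R.
  by rewrite (@le_trans _ _ 1%R) ?exprn_ile1// lerDl powR_ge0.
rewrite -powR_mulrn// (@le_trans _ _ (enorm x `^ (2 + delta))%R)//.
  by rewrite ler_powR ?(ltW n1)// lerDl ltW.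
by rewrite lerDr.
Qed.

Section symmetrize.
Context d' (X : measurableType d').

Lemma ge0_symmetrize (Q : probability (X * X)%type R) (f : X * X -> \bar R) :
  symmetric_measure Q -> measurable_fun setT f -> (forall z, 0 <= f z) ->
  \int[Q]_z f z + \int[Q]_z f z = \int[Q]_z (f z + f (swap_pair z)).
Proof.
move=> symQ mf f0; rewrite ge0_integralD//.
  by rewrite symmetric_measure_integral.
by apply: measurableT_comp => //; exact: measurable_swap_pair.
Qed.

End symmetrize.

Variables (mu0 mu1 : probability Rd R) (g : probability Z R).

(** Exchanging the second coordinates of the two points [z.1] and [z.2] raises
    the total cost by this quantity. *)
Definition exchange_gain (z : Z * Z) : R :=
  edot (z.1.1 - z.2.1) (z.1.2 - z.2.2).

Lemma exchange_costE (z : Z * Z) :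
  (quad_cost (z.1.1, z.2.2) + quad_cost (z.2.1, z.1.2) =
   quad_cost z.1 + quad_cost z.2 + exchange_gain z)%R.
Proof.
rewrite /exchange_gain !quad_costE; case: z => -[x y] [x' y'] /=.
rewrite !edotE (edotC y x) (edotC y' x) (edotC y x') (edotC y' x'); lra.
Qed.

Lemma exchange_gain_swap z : exchange_gain (swap_pair z) = exchange_gain z.
Proof.
rewrite /exchange_gain -[in RHS](opprB z.2.1) -[in RHS](opprB z.2.2).
by rewrite edotNl edotNr opprK.
Qed.

Lemma measurable_exchange_gain : measurable_fun setT exchange_gain.
Proof.
apply: measurable_edot; apply: measurable_rVB;
  by do 2 (apply: measurableT_comp => //).
Qed.

Lemma measurable_transport_cost_ge0 (f : Z * Z -> Z) : measurable_fun setT f ->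
  measurable_fun setT (fun z => (quad_cost (f z))%:E : \bar R).
Proof. by move=> mf; exact/measurable_EFinP/measurable_quad_cost. Qed.

Lemma double_transport_cost (g' : probability Z R) (Q : probability (Z * Z)%type R)
    (phi : Z * Z -> Z) :
  symmetric_measure Q -> measurable_fun setT phi ->
  transport_cost g' = \int[Q]_z (quad_cost (phi z))%:E ->
  transport_cost g' + transport_cost g' =
    \int[Q]_z ((quad_cost (phi z))%:E + (quad_cost (phi (swap_pair z)))%:E).
Proof.
move=> symQ mphi ->.
rewrite -(ge0_symmetrize (f := fun z => (quad_cost (phi z))%:E))//.
  exact: measurable_transport_cost_ge0.
by move=> z; rewrite lee_fin quad_cost_ge0.
Qed.

Lemma self_coupling_cost (g' : probability Z R) (Q : probability (Z * Z)%type R) :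
  is_coupling g' g' Q -> transport_cost g' = \int[Q]_z (quad_cost z.1)%:E.
Proof.
move=> cQ; rewrite (coupling_integral_fst cQ (f := fun z => (quad_cost z)%:E))//.
exact/measurable_EFinP/measurable_quad_cost.
Qed.

(** If exchanging partners lowered the cost on a non-negligible set of pairs,
    doing so exactly there would produce a cheaper plan. *)
Lemma ot_plan_monotone : is_ot_plan mu0 mu1 g -> transport_cost g < +oo ->
  {ae (g \x g)%E, forall z, (0 <= exchange_gain z)%R}.
Proof.
move=> [cg ming] gfin.
pose Q : probability (Z * Z)%type R := (g \x g)%E.
have symQ : symmetric_measure Q := @symmetric_product _ _ _ g.
have cQ : is_coupling g g Q := self_coupling_product g.
pose b z := (exchange_gain z < 0)%R.
have mb : measurable_fun setT b.
  by apply: measurable_fun_ltr => //; exact: measurable_exchange_gain.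
have bC z : b (swap_pair z) = b z by rewrite /b exchange_gain_swap.
have [g' [cg' g'E]] := recoupling cg cQ symQ mb bC.
pose phi (z : Z * Z) : Z := (z.1.1, if b z then z.2.2 else z.1.2).
have mphi : measurable_fun setT phi.
  apply: measurable_fun_pair; first exact: measurableT_comp.
  by apply: measurable_fun_ifT => //; exact: measurableT_comp.
pose gain z := Num.max 0%R (- exchange_gain z)%R.
have mgain : measurable_fun setT gain.
  apply: measurable_maxr => //; apply: measurableT_comp => //.
  exact: measurable_exchange_gain.
have gain0 z : (0 <= gain z)%R by rewrite le_max lexx.
have m1 : measurable_fun setT (fun z : Z * Z => (quad_cost z.1)%:E : \bar R).
  exact: measurable_transport_cost_ge0.
have m2 := measurable_transport_cost_ge0 mphi.
have cost2 := double_transport_cost symQ measurable_fst (self_coupling_cost cQ).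
have cost2' : transport_cost g' + transport_cost g' =
    \int[Q]_z ((quad_cost (phi z))%:E + (quad_cost (phi (swap_pair z)))%:E).
  apply: double_transport_cost => //; apply: g'E.
  exact/measurable_EFinP/measurable_quad_cost.
have cost2E : transport_cost g + transport_cost g =
    transport_cost g' + transport_cost g' + \int[Q]_z (gain z)%:E.
  rewrite cost2 cost2' -ge0_integralD//.
  - apply: eq_integral => z _; rewrite -!EFinD; congr EFin.
    have := exchange_costE z; rewrite /phi bC /gain /b.
    case: z => -[x y] [x' y'] /=; set e := exchange_gain _.
    have [e0|e0] := ltP e 0%R => /= E.
      by rewrite E max_r ?oppr_ge0 ?ltW// addrK.
    by rewrite max_l ?oppr_le0// addr0.
  - by move=> z _; rewrite -EFinD lee_fin addr_ge0// quad_cost_ge0.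
  - apply: emeasurable_funD => //.
    exact: (measurableT_comp m2 (@measurable_swap_pair _ _)).
  - by move=> z _; rewrite lee_fin.
  - exact/measurable_EFinP.
have cost_fin : transport_cost g \is a fin_num.
  rewrite ge0_fin_numE//; apply: integral_ge0 => z _.
  by rewrite lee_fin quad_cost_ge0.
have int0 : \int[Q]_z (gain z)%:E = 0.
  apply/eqP; rewrite eq_le; apply/andP; split; last first.
    by apply: integral_ge0 => z _; rewrite lee_fin.
  have c2_fin : transport_cost g + transport_cost g \is a fin_num.
    by rewrite fin_numD cost_fin.
  rewrite -(leeD2lE _ _ c2_fin) adde0 {2}cost2E.
  by apply: leeD2r; apply: leeD; exact: ming.
have mg : measurable_fun setT (fun z => (gain z)%:E : \bar R) by exact/measurable_EFinP.
have intabs0 : \int[Q]_z `|(gain z)%:E| = 0.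
  by rewrite -int0; apply: eq_integral => z _; rewrite gee0_abs// lee_fin.
have := (ae_eq_integral_abs Q measurableT mg).1 intabs0.
apply: filterS => z /(_ I)/= [].
rewrite /gain => gain_z; have : (- exchange_gain z <= 0)%R.
  by rewrite -gain_z le_max lexx orbT.
by rewrite oppr_le0.
Qed.

End costs.

(** * Entropy of the partition into cubes *)

Section integrability.
Context d (T : measurableType d) (R : realType) (mu : {measure set T -> \bar R}).

Lemma ge0_integrable_lty (f : T -> R) : measurable_fun setT f ->
  (forall x, (0 <= f x)%R) -> \int[mu]_x (f x)%:E < +oo ->
  mu.-integrable setT (fun x => (f x)%:E).
Proof.
move=> mf f0 foo; apply/integrableP; split; first exact/measurable_EFinP.
by under eq_integral => x _ do rewrite gee0_abs ?lee_fin//.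
Qed.

Lemma integral_EFin_integrable (f : T -> \bar R) (r : R) :
  measurable_fun setT f -> \int[mu]_x f x = r%:E -> mu.-integrable setT f.
Proof.
move=> mf; rewrite integralE => fr; apply/integrableP; split => //.
have p0 : 0 <= \int[mu]_x f^\+ x by exact: integral_ge0.
have n0 : 0 <= \int[mu]_x f^\- x by exact: integral_ge0.
rewrite (_ : (fun x => `|f x|) = f^\+ \+ f^\-); last by rewrite -fune_abse.
rewrite ge0_integralD//; [|exact: measurable_funepos|exact: measurable_funeneg].
move: fr p0 n0; case: (\int[mu]_x f^\+ x) => [a||]//;
  by case: (\int[mu]_x f^\- x) => [b||]// _ _ _; rewrite -EFinD ltry.
Qed.

End integrability.

Section integrable_edot.
Context {R : realType} {n : nat} d (T : measurableType d) (P : probability T R).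

Lemma integrable_moment2 (mu : probability 'rV[R]_n R) (M : R) :
  \int[mu]_x (edot x x)%:E <= M%:E ->
  mu.-integrable setT (fun x => (edot x x)%:E).
Proof.
move=> MP; apply: ge0_integrable_lty; first exact: measurable_edot.
  by move=> x; exact: edot_ge0.
by rewrite (le_lt_trans MP)// ltry.
Qed.

Lemma integrable_edotB (u w : T -> 'rV[R]_n) :
  measurable_fun setT u -> measurable_fun setT w ->
  P.-integrable setT (fun t => (edot (u t) (u t))%:E) ->
  P.-integrable setT (fun t => (edot (w t) (w t))%:E) ->
  P.-integrable setT (fun t => (edot (u t - w t)%R (u t - w t)%R)%:E).
Proof.
move=> mu mw iu iw.
have i2 : P.-integrable setT (fun t => 2%:E * (edot (u t) (u t))%:E +
    2%:E * (edot (w t) (w t))%:E).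
  by apply: integrableD => //; exact: integrableZl.
apply: le_integrable i2 => //.
  apply/measurable_EFinP; apply: measurable_edot; exact: measurable_rVB.
move=> t _; rewrite -!EFinM -EFinD lee_fin !ger0_norm ?edot_ge0//; last first.
  by rewrite addr_ge0// mulr_ge0// edot_ge0.
by have := edot_add_le (u t) (- w t)%R; rewrite edotNl edotNr opprK.
Qed.

End integrable_edot.

Section product_image.
Context d1 d2 (T1 : measurableType d1) (T2 : measurableType d2) (R : realType).

Lemma product_null_dominates (m1 n1 : {sigma_finite_measure set T1 -> \bar R})
    (m2 n2 : {sigma_finite_measure set T2 -> \bar R}) :
  m1 `<< n1 -> m2 `<< n2 -> (m1 \x m2)%E `<< (n1 \x n2)%E.
Proof.
move=> mn1 /null_content_dominatesP mn2; apply/null_content_dominatesP => A mA A0.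
have xA x : measurable (xsection A x) by exact: measurable_xsection.
have n1A : \int[n1]_x `|n2 (xsection A x)| = 0.
  by rewrite -[RHS]A0; apply: eq_integral => x _; rewrite gee0_abs.
have := (ae_eq_integral_abs n1 measurableT (measurable_fun_xsection n2 mA)).1 n1A.
move=> /(null_dominates_ae mn1) n2A0.
rewrite /product_measure1/= (ae_eq_integral (cst 0)) ?integral0//.
  exact: measurable_fun_xsection.
by apply: filterS n2A0 => x /(_ I) /= n0 _; exact: mn2.
Qed.

Variables (mu0 : probability T1 R) (mu1 : probability T2 R).
Variable g : probability (T1 * T2)%type R.
Hypothesis cg : is_coupling mu0 mu1 g.

(** Two independent points of a plan have independent first and second
    coordinates, whatever the plan. *)
Lemma ge0_integral_product_coupling (f : T1 * T2 -> \bar R) :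
  measurable_fun setT f -> (forall z, 0 <= f z) ->
  \int[(g \x g)%E]_z f (z.1.1, z.2.2) = \int[mu0]_x \int[mu1]_y f (x, y).
Proof.
move=> mf f0.
rewrite (fubini_tonelli1 (fun z => f (z.1.1, z.2.2)))//; last first.
  apply: measurableT_comp => //; apply: measurable_fun_pair;
    by do 2 (apply: measurableT_comp => //).
rewrite /fubini_F/= -(coupling_integral_fst cg
    (f := fun x => \int[mu1]_y f (x, y))); last first.
  exact: (measurable_fun_fubini_tonelli_F f).
apply: eq_integral => z _.
rewrite (coupling_integral_snd cg (f := fun y => f (z.1, y)))//.
exact: measurable_fun_pair2.
Qed.

End product_image.

Lemma ae_image d1 d2 (X : measurableType d1) (Y : measurableType d2)
    (R : realType) (P : {measure set X -> \bar R}) (Q : {measure set Y -> \bar R})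
    (phi : X -> Y) (E : Y -> Prop) :
  measurable_fun setT phi ->
  (forall f : Y -> \bar R, measurable_fun setT f ->
     \int[Q]_y f y = \int[P]_x f (phi x)) ->
  {ae Q, forall y, E y} -> {ae P, forall x, E (phi x)}.
Proof.
move=> mphi QP [N [mN N0 EN]].
have mphiN : measurable (phi @^-1` N).
  by rewrite -[X in measurable X]setTI; exact: mphi.
exists (phi @^-1` N); split => //; last by move=> x /= /EN.
rewrite -integral_indicT// -N0 -integral_indicT//.
rewrite (QP (fun y => (\1_N y)%:E))//.
exact/measurable_EFinP/measurable_indic.
Qed.

Section fiber_entropy.
Context {R : realType} (d : nat).
Local Notation Rd := ('rV[R]_d).

Definition cell_gauss (r : R) (k : 'rV[int]_d) : \bar R :=
  \int[lebesgue_rV d]_w ((gaussian 0 1 w)%:E * (\1_(cell_index r @^-1` [set k]) w)%:E).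

(** For [w'] in the cell of [w] one has
    [edot w' w' <= 2 * edot w w + 2 * d * r ^+ 2], whence the constant [d] in the
    exponent. *)
Lemma cell_gauss_ge (r : R) (w : Rd) : (0 < r <= 1)%R ->
  ((Num.sqrt (2 * pi) ^- d * expR (- (edot w w + d%:R))) * r ^+ d)%:E <=
  cell_gauss r (cell_index r w).
Proof.
move=> /andP[r0 r1]; set c := (_ ^- d * _)%R.
have c0 : (0 <= c)%R by rewrite mulr_ge0 ?expR_ge0.
have mk := measurable_cell (cell_index r w) r0.
rewrite EFinM -(lebesgue_cell (cell_index r w) r0) -integral_indicT//.
rewrite -ge0_integralZl//.
- rewrite /cell_gauss; apply: ge0_le_integral => //.
  + by move=> x _; rewrite mule_ge0 ?lee_fin.
  + by apply: emeasurable_funM => //; exact/measurable_EFinP/measurable_indic.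
  + apply: emeasurable_funM; last exact/measurable_EFinP/measurable_indic.
    by apply/measurable_EFinP; apply: measurable_gaussian.
  move=> x _; rewrite indicE; case: (boolP (_ \in _)); last by rewrite !mule0.
  rewrite inE/= => xw; rewrite !mule1 lee_fin gaussianE// /c.
  rewrite expr1n !mulr1 subr0 ler_wpM2l// ?ler_expR.
  have := cell_diam r0 xw; have := edot_add_le (x - w)%R w; rewrite subrK => h1 h2.
  have : (d%:R * r ^+ 2 <= d%:R)%R by rewrite ler_piMr// exprn_ile1// ltW.
  by rewrite mulNr; lra.
- by apply/measurable_EFinP; exact: measurable_indic.
Qed.

Lemma cell_gauss_le1 (r : R) k : (0 < r)%R -> cell_gauss r k <= 1.
Proof.
move=> r0; rewrite -(integral_gaussian (0 : Rd) (@ltr01 R)).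
have mg : measurable_fun setT (fun w : Rd => (gaussian 0 1 w)%:E : \bar R).
  by apply/measurable_EFinP; apply: measurable_gaussian.
have mi : measurable_fun setT
    (fun w : Rd => (\1_(cell_index r @^-1` [set k]) w)%:E : \bar R).
  by apply/measurable_EFinP/measurable_indic; exact: measurable_cell.
apply: ge0_le_integral => //.
- by move=> x _; rewrite -EFinM lee_fin mulr_ge0// gaussian_ge0.
- exact: emeasurable_funM.
by move=> x _; rewrite -EFinM lee_fin ler_piMr ?gaussian_ge0// indicE lern1 leq_b1.
Qed.

Lemma cell_gauss_ge0 (r : R) k : 0 <= cell_gauss r k.
Proof.
by apply: integral_ge0 => w _; rewrite -EFinM lee_fin mulr_ge0// gaussian_ge0.
Qed.

Context d' (T : measurableType d') (g : probability T R) (u : T -> Rd) (r : R).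
Hypotheses (hu : measurable_fun setT u) (r01 : (0 < r <= 1)%R).

Let K t := cell_index r (u t).
Let p t : R := fine (g (K @^-1` [set K t])).
Let r0 : (0 < r)%R. Proof. by case/andP: r01. Qed.

Lemma measurable_cell_preimage k : measurable (K @^-1` [set k]).
Proof.
have -> : K @^-1` [set k] = u @^-1` (cell_index r @^-1` [set k]) by [].
by rewrite -[X in measurable X]setTI; apply: hu => //; exact: measurable_cell.
Qed.
Local Notation mK := measurable_cell_preimage.

(** Exchanging the integrals over [T] and over the space, the integral over [T]
    of the indicator of a cell divided by its mass is [1] or [0], and what
    remains is the total mass of the Gaussian. *)
Lemma integral_cell_gauss_div :
  \int[g]_t ((p t)^-1%:E * cell_gauss r (K t)) <= 1.
Proof.
pose P k : R := fine (g (K @^-1` [set k])).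
have P0 k : (0 <= P k)%R by exact: fine_ge0.
pose K2 (z : T * Rd) := (K z.1, cell_index r z.2).
have mK2 kl : measurable (K2 @^-1` [set kl]).
  have -> : K2 @^-1` [set kl] =
      (K @^-1` [set kl.1]) `*` (cell_index r @^-1` [set kl.2]).
    apply/seteqP; split => [z <-//|z [/= z1 z2]]; rewrite /K2 z1 z2.
    by case: kl {z1 z2}.
  by apply: measurableX; [exact: mK|exact: measurable_cell].
pose h (kl : 'rV[int]_d * 'rV[int]_d) : R := ((P kl.1)^-1 * (kl.2 == kl.1)%:R)%R.
pose F (z : T * Rd) : \bar R := (gaussian 0 1 z.2)%:E * (h (K2 z))%:E.
have mF : measurable_fun setT F.
  apply: emeasurable_funM; apply/measurable_EFinP.
    by apply: measurable_gaussian => //; exact: measurableT_comp.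
  exact: (measurable_fun_countable mK2 h).
have F0 z : 0 <= F z.
  by rewrite /F -EFinM lee_fin mulr_ge0 ?gaussian_ge0// mulr_ge0// invr_ge0.
have -> : \int[g]_t ((p t)^-1%:E * cell_gauss r (K t)) =
    \int[g]_t \int[lebesgue_rV d]_w F (t, w).
  apply: eq_integral => t _; rewrite /cell_gauss -ge0_integralZl//.
  - apply: eq_integral => w _; rewrite /F /h/= muleCA -!EFinM; congr (_ * (_ * _))%:E%R.
    rewrite indicE; congr (nat_of_bool _)%:R.
    by apply/idP/eqP => [/[!inE]|<-]; rewrite ?inE.
  - apply: emeasurable_funM; apply/measurable_EFinP.
      by apply: measurable_gaussian.
    by apply: measurable_indic; exact: measurable_cell.
  - by move=> w _; rewrite mule_ge0 ?lee_fin ?gaussian_ge0.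
  - by rewrite lee_fin invr_ge0 fine_ge0.
rewrite (fubini_tonelli F)// -(integral_gaussian (0 : Rd) (@ltr01 R)).
apply: ge0_le_integral => //.
- by move=> w _; exact: integral_ge0.
- exact: (measurable_fun_fubini_tonelli_G F).
- by apply/measurable_EFinP; apply: measurable_gaussian.
move=> w _; pose k := cell_index r w.
have -> : \int[g]_t F (t, w) =
    \int[g]_t ((gaussian 0 1 w * (P k)^-1)%:E * (\1_(K @^-1` [set k]) t)%:E).
  apply: eq_integral => t _; rewrite /F /h/= -!EFinM -mulrA; congr (_ * _)%:E%R.
  rewrite indicE; case: eqP => Kt.
    by rewrite mem_set//= /k Kt.
  by rewrite memNset ?mulr0//= => /esym.
rewrite ge0_integralZl//; last 2 first.
- by apply/measurable_EFinP/measurable_indic; exact: mK.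
- by rewrite lee_fin mulr_ge0 ?gaussian_ge0// invr_ge0.
rewrite integral_indicT; last exact: mK.
rewrite [X in _ * X](_ : _ = (P k)%:E); last first.
  by rewrite fineK// fin_num_measure//; exact: mK.
rewrite -EFinM lee_fin -mulrA ler_piMr ?gaussian_ge0//.
by have [->|Pk] := eqVneq (P k) 0%R; rewrite ?mulr0// mulVf.
Qed.

(** The Gibbs inequality on the countable set of cells: the entropy of the
    partition is at most its cross entropy with the Gaussian masses of the cells,
    and these are of order [r ^+ d]. *)
Lemma fiber_entropy_le (M : R) : \int[g]_t (edot (u t) (u t))%:E <= M%:E ->
  \int[g]_t (ln (p t)^-1)%:E <=
  (d%:R * ln r^-1 + d%:R * ln (Num.sqrt (2 * pi)) + d%:R + M)%:E.
Proof.
move=> uM; set C := (d%:R * _ + _ + _)%R.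
have muu : measurable_fun setT (fun t => edot (u t) (u t)) by exact: measurable_edot.
have mp : measurable_fun setT p.
  exact: (measurable_fun_countable mK (fun k => fine (g (K @^-1` [set k])))).
pose q t : R := fine (cell_gauss r (K t)).
have qE t : (q t)%:E = cell_gauss r (K t).
  rewrite fineK// ge0_fin_numE ?cell_gauss_ge0//.
  by rewrite (le_lt_trans (cell_gauss_le1 _ r0))// ltry.
have mq : measurable_fun setT q.
  exact: (measurable_fun_countable mK (fun k => fine (cell_gauss r k))).
have p0 t : (0 <= p t)%R by exact: fine_ge0.
have q0 t : (0 <= q t)%R by rewrite -lee_fin qE cell_gauss_ge0.
have mqp : measurable_fun setT (fun t => (p t)^-1 * q t)%R.
  by apply: measurable_funM => //; exact: measurable_inv_ge0.
have qp1 : \int[g]_t ((p t)^-1 * q t)%:E <= 1.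
  under eq_integral => t _ do rewrite EFinM qE.
  exact: integral_cell_gauss_div.
have iqp : g.-integrable setT (fun t => ((p t)^-1 * q t)%:E).
  apply: ge0_integrable_lty => //; first by move=> t; rewrite mulr_ge0 ?invr_ge0.
  by rewrite (le_lt_trans qp1)// ltry.
have iuu : g.-integrable setT (fun t => (edot (u t) (u t))%:E).
  apply: ge0_integrable_lty => //; first by move=> t; exact: edot_ge0.
  by rewrite (le_lt_trans uM)// ltry.
have iC c : g.-integrable setT (cst c%:E) by exact: finite_measure_integrable_cst.
pose U t : \bar R := ((cst (C - 1)%:E t + (edot (u t) (u t))%:E) +
  ((p t)^-1 * q t)%:E).
apply: (@le_trans _ _ (\int[g]_t U t)); last first.
  rewrite integralD//; last exact: integrableD.
  rewrite integralD// integral_probability_cst.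
  rewrite (_ : (C + M)%:E = (C - 1)%:E + M%:E + 1).
    by rewrite leeD// leeD.
  by rewrite -!EFinD; congr EFin; lra.
apply: ae_le_integral.
- apply/measurable_EFinP/measurableT_comp => //; exact: measurable_inv_ge0.
- apply: emeasurable_funD; last exact/measurable_EFinP.
  by apply: emeasurable_funD => //; exact/measurable_EFinP.
apply: filterS (ae_fiber_gt0 mK g) => t; rewrite -/(p t) => pt.
rewrite /U -!EFinD lee_fin.
have s0 : (0 < Num.sqrt (2 * pi) ^- d :> R)%R.
  by rewrite invr_gt0 exprn_gt0// sqrtr_gt0 mulr_gt0// pi_gt0.
set B := (Num.sqrt (2 * pi) ^- d * expR (- (edot (u t) (u t) + d%:R)) * r ^+ d)%R.
have B0 : (0 < B)%R by rewrite !mulr_gt0 ?expR_gt0 ?exprn_gt0.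
have Bq : (B <= q t)%R by rewrite -lee_fin qE; exact: cell_gauss_ge.
have qt : (0 < q t)%R by exact: lt_le_trans Bq.
have lnqp : (ln ((p t)^-1 * q t) <= (p t)^-1 * q t - 1)%R.
  have h : (-1 < (p t)^-1 * q t - 1)%R.
    by rewrite ltrBDr addNr mulr_gt0// invr_gt0.
  by have := le_ln1Dx h; rewrite [(1 + _)%R]addrC subrK.
have lnB : (ln B <= ln (q t))%R by rewrite ler_ln.
move: lnqp; rewrite lnM ?posrE ?invr_gt0//.
have a0 : (0 < Num.sqrt (2 * pi) :> R)%R by rewrite sqrtr_gt0 mulr_gt0// pi_gt0.
have lnBE : ln B = (- (d%:R * ln (Num.sqrt (2 * pi))) -
    (edot (u t) (u t) + d%:R) + d%:R * ln r)%R.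
  rewrite /B lnM ?posrE ?exprn_gt0 ?mulr_gt0 ?expR_gt0//.
  rewrite lnM ?posrE ?expR_gt0// expRK lnV ?posrE ?exprn_gt0//.
  by rewrite !lnXn// !mulr_natl.
have lnr : (ln r^-1 = - ln r)%R by rewrite lnV.
move: lnB; rewrite lnBE /C lnr; lra.
Qed.

End fiber_entropy.

(** * The block approximation *)

Section competitor.
Context {R : realType} (d : nat).
Local Notation Rd := ('rV[R]_d).
Local Notation Z := (Rd * Rd)%type.
Local Notation leb := (lebesgue_rV d).
Local Notation leb2 := (sigma_finite_prod (lebesgue_rV d) (lebesgue_rV d)).
Variables (mu0 mu1 : probability Rd R).

Lemma coupling_moment2_add (g : probability Z R) (M0 M1 : R) :
  is_coupling mu0 mu1 g ->
  \int[mu0]_x (edot x x)%:E <= M0%:E -> \int[mu1]_x (edot x x)%:E <= M1%:E ->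
  \int[g]_z (edot (z.1 + z.2) (z.1 + z.2)%R)%:E <= (2 * M0 + 2 * M1)%:E.
Proof.
move=> cg H0 H1.
have m1 : measurable_fun setT (fun z : Z => edot z.1 z.1) by exact: measurable_edot.
have m2 : measurable_fun setT (fun z : Z => edot z.2 z.2) by exact: measurable_edot.
have m : measurable_fun setT (fun x : Rd => edot x x) by exact: measurable_edot.
have ms : measurable_fun setT (fun z : Z => edot (z.1 + z.2)%R (z.1 + z.2)%R).
  by apply: measurable_edot; apply: measurable_rVD.
apply: (@le_trans _ _ (\int[g]_z (2%:E * (edot z.1 z.1)%:E + 2%:E * (edot z.2 z.2)%:E))).
  apply: ge0_le_integral => //.
  - by move=> z _; rewrite lee_fin edot_ge0.
  - exact/measurable_EFinP.
  - by apply: emeasurable_funD; apply: emeasurable_funM => //; exact/measurable_EFinP.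
  by move=> z _; rewrite -!EFinM -EFinD lee_fin edot_add_le.
rewrite ge0_integralD//; last 4 first.
- by move=> z _; rewrite mule_ge0// lee_fin edot_ge0.
- by apply: emeasurable_funM => //; exact/measurable_EFinP.
- by move=> z _; rewrite mule_ge0// lee_fin edot_ge0.
- by apply: emeasurable_funM => //; exact/measurable_EFinP.
rewrite !ge0_integralZl//; try by move=> z _; rewrite lee_fin edot_ge0.
- rewrite (coupling_integral_fst cg (f := fun x => (edot x x)%:E)); last exact/measurable_EFinP.
  rewrite (coupling_integral_snd cg (f := fun x => (edot x x)%:E)); last exact/measurable_EFinP.
  rewrite (EFinD (2 * M0)%R (2 * M1)%R) (EFinM 2 M0) (EFinM 2 M1).
  by rewrite leeD// lee_wpmul2l.
- exact/measurable_EFinP.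
- exact/measurable_EFinP.
Qed.

Variables (g : probability Z R) (r h0 h1 M0 M1 : R).
Hypotheses (cg : is_coupling mu0 mu1 g) (r01 : (0 < r <= 1)%R).
Hypotheses (dom0 : mu0 `<< leb) (dom1 : mu1 `<< leb).
Hypothesis (M0P : \int[mu0]_x (edot x x)%:E <= M0%:E).
Hypothesis (M1P : \int[mu1]_x (edot x x)%:E <= M1%:E).
Hypotheses (h0P : entropy leb mu0 = h0%:E) (h1P : entropy leb mu1 = h1%:E).

Local Notation rho0 := (density leb mu0).
Local Notation rho1 := (density leb mu1).

Let integral_ratio (rho : Z -> R) : measurable_fun setT rho ->
  (forall z, (0 <= rho z)%R) -> \int[leb2]_z (rho z)%:E <= 1 ->
  \int[(g \x g)%E]_z (rho (z.1.1, z.2.2) / rho0 z.1.1 / rho1 z.2.2)%:E <= 1.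
Proof.
move=> mrho rho_ge0 rho1_le.
have d0 := density_ge0 dom0; have d1 := density_ge0 dom1.
have mi0 : measurable_fun setT (fun x => (rho0 x)^-1)%R.
  by apply: measurable_inv_ge0 => //; exact: measurable_density.
have mi1 : measurable_fun setT (fun x => (rho1 x)^-1)%R.
  by apply: measurable_inv_ge0 => //; exact: measurable_density.
have mq : measurable_fun setT (fun z => rho z / rho0 z.1)%R.
  by apply: measurable_funM => //; exact: (measurableT_comp mi0 measurable_fst).
pose q (z : Z) := (rho z / rho0 z.1)%R.
pose f (z : Z) := (q z / rho1 z.2)%:E.
have mf : measurable_fun setT f.
  apply/measurable_EFinP/measurable_funM => //.
  exact: (measurableT_comp mi1 measurable_snd).
have q0 z : (0 <= q z)%R by rewrite divr_ge0.
have f0 z : 0 <= f z by rewrite lee_fin divr_ge0.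
rewrite (ge0_integral_product_coupling cg mf f0).
apply: (@le_trans _ _ (\int[mu0]_x \int[leb]_y (q (x, y))%:E)).
  apply: ge0_le_integral => //.
  - by move=> x _; exact: integral_ge0.
  - exact: (measurable_fun_fubini_tonelli_F f).
  - apply: (measurable_fun_fubini_tonelli_F (fun z => (q z)%:E)).
      exact/measurable_EFinP.
    by move=> z; rewrite lee_fin.
  move=> x _; apply: (integral_div_density_le dom1 (q := fun y => q (x, y))) => //.
  exact: measurable_fun_pair2.
rewrite (fubini_tonelli (fun z => (q z)%:E)); last 2 first.
- exact/measurable_EFinP.
- by move=> z; rewrite lee_fin.
apply: le_trans rho1_le; rewrite /sigma_finite_prod.
rewrite (fubini_tonelli2 (fun z => (rho z)%:E)); last 2 first.
- exact/measurable_EFinP.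
- by move=> z; rewrite lee_fin.
apply: ge0_le_integral => //.
- by move=> x _; apply: integral_ge0 => y _; rewrite lee_fin.
- apply: (measurable_fun_fubini_tonelli_G (fun z => (q z)%:E)).
    exact/measurable_EFinP.
  by move=> z; rewrite lee_fin.
- apply: (measurable_fun_fubini_tonelli_G (fun z => (rho z)%:E)).
    exact/measurable_EFinP.
  by move=> z; rewrite lee_fin.
move=> y _; apply: (integral_div_density_le dom0 (q := fun x => rho (x, y))) => //.
exact: measurable_fun_pair1.
Qed.

(** The two coordinates are made independent conditionally on the cell of
    [z.1 + z.2]. The loss of transport cost is quadratic in [r] because
    [4 * edot a b <= edot (a + b) (a + b)]. The mutual information of the two
    coordinates is at most the entropy of the partition, and the cells fill the
    [d]-dimensional space in which [z.1 + z.2] lives, so that the coefficient of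
    [ln r^-1] is [d] and not [2 * d]. *)
Lemma block_approximation : exists g' : probability Z R,
  [/\ is_coupling mu0 mu1 g',
      transport_cost g' <= transport_cost g + (d%:R * r ^+ 2 / 8)%:E &
      entropy leb2 g' <= (d%:R * ln r^-1 + d%:R * ln (Num.sqrt (2 * pi)) + d%:R +
        (2 * M0 + 2 * M1) + h0 + h1)%:E].
Proof.
have r0 : (0 < r)%R by case/andP : r01.
pose u (z : Z) := (z.1 + z.2)%R.
have hu : measurable_fun setT u by exact: measurable_rVD.
pose K z := cell_index r (u z).
have mK := measurable_cell_preimage hu r01.
have [Q [cQ symQ KQ domQ Qint]] := fiber_self_coupling g mK.
pose b (z : Z * Z) := true.
have mb : measurable_fun setT b by exact: measurable_cst.
have [g' [cg' g'E]] := recoupling cg cQ symQ mb (fun=> erefl).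
rewrite /b/= in g'E.
pose phi (z : Z * Z) : Z := (z.1.1, z.2.2).
have mphi : measurable_fun setT phi.
  by apply: measurable_fun_pair; do 2 (apply: measurableT_comp => //).
exists g'; split => //.
- have mc := measurable_transport_cost_ge0 mphi.
  have mc1 : measurable_fun setT (fun z : Z * Z => (quad_cost z.1)%:E : \bar R).
    exact: measurable_transport_cost_ge0.
  have cost2 := double_transport_cost symQ measurable_fst (self_coupling_cost cQ).
  have cost2' : transport_cost g' + transport_cost g' =
      \int[Q]_z ((quad_cost (phi z))%:E + (quad_cost (phi (swap_pair z)))%:E).
    apply: double_transport_cost => //; apply: g'E.
    exact/measurable_EFinP/measurable_quad_cost.
  pose c := (d%:R * r ^+ 2 / 8 + d%:R * r ^+ 2 / 8 : R)%R.
  have mc2 : measurable_fun setT (fun z : Z * Z => (quad_cost (swap_pair z).1)%:E : \bar R).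
    exact: (measurableT_comp mc1 (@measurable_swap_pair _ _)).
  have mc2' : measurable_fun setT (fun z : Z * Z => (quad_cost (phi (swap_pair z)))%:E : \bar R).
    exact: (measurableT_comp mc (@measurable_swap_pair _ _)).
  have : transport_cost g' + transport_cost g' <=
      transport_cost g + transport_cost g + c%:E.
    rewrite cost2 cost2' -[c%:E](integral_probability_cst Q) -ge0_integralD//.
    + apply: ae_le_integral; [exact: emeasurable_funD| |].
        by apply: emeasurable_funD => //; exact: emeasurable_funD.
      apply: filterS KQ => z Kz; rewrite /= -!EFinD lee_fin.
      have := exchange_costE z; rewrite /phi/= => ->; rewrite lerD2l.
      have := cell_diam r0 Kz; have := edot_mul4_le (z.1.1 - z.2.1) (z.1.2 - z.2.2).
      rewrite /exchange_gain /c /u opprD addrACA; lra.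
    + by move=> z _; rewrite -EFinD lee_fin addr_ge0// quad_cost_ge0.
    + exact: emeasurable_funD.
    + by move=> z _; rewrite lee_fin addr_ge0// divr_ge0// mulr_ge0// exprn_ge0// ltW.
  have : 0 <= transport_cost g.
    by apply: integral_ge0 => z _; rewrite lee_fin quad_cost_ge0.
  have : 0 <= transport_cost g'.
    by apply: integral_ge0 => z _; rewrite lee_fin quad_cost_ge0.
  case: (transport_cost g') => [a||]//; case: (transport_cost g) => [a'||]//=;
    last by move=> _ _ _; exact: leey.
    by rewrite -!EFinD !lee_fin => _ _; rewrite /c; lra.
- have dom' : g' `<< leb2.
    apply/null_content_dominatesP => A mA A0.
    have gg0 : (g \x g)%E (phi @^-1` A) = 0.
      have mA' : measurable (phi @^-1` A).
        by rewrite -[X in measurable X]setTI; exact: mphi.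
      have mi : measurable_fun setT (fun z : Z => (\1_A z)%:E : \bar R).
        exact/measurable_EFinP/measurable_indic.
      apply: etrans (esym (integral_indicT _ mA')) _.
      rewrite (ge0_integral_product_coupling cg mi)//.
      rewrite -(fubini_tonelli1 (fun z : Z => (\1_A z)%:E))//.
      rewrite integral_indicT//.
      have /null_content_dominatesP := product_null_dominates dom0 dom1.
      by apply.
    have mi : measurable_fun setT (fun z : Z => (\1_A z)%:E : \bar R).
      exact/measurable_EFinP/measurable_indic.
    apply: etrans (esym (integral_indicT _ mA)) _; rewrite g'E//.
    have mA' : measurable (phi @^-1` A).
      by rewrite -[X in measurable X]setTI; exact: mphi.
    apply: etrans (integral_indicT _ mA') _.
    by move/null_content_dominatesP : domQ; exact.
  pose rho := density leb2 g'.
  have entE : entropy leb2 g' = \int[g']_z (ln (rho z))%:E := entropyE dom'.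
  rewrite entE.
  have mrho : measurable_fun setT rho := measurable_density dom'.
  have rho_ge0 z : (0 <= rho z)%R := density_ge0 dom' z.
  pose p z := fine (g (K @^-1` [set K z])).
  have mp : measurable_fun setT p.
    exact: (measurable_fun_countable mK (fun k => fine (g (K @^-1` [set k])))).
  (* The logarithm of rho is compared with that of rho0 * rho1 / p through
     ln t <= t - 1, where t is ratio * p. *)
  pose A z := ln (p z)^-1.
  pose ratio (z : Z * Z) := (rho (phi z) / rho0 z.1.1 / rho1 z.2.2)%R.
  have mA : measurable_fun setT (fun z => (A z)%:E : \bar R).
    apply/measurable_EFinP/measurableT_comp => //; apply: measurable_inv_ge0 => // z.
    exact: fine_ge0.
  have mratio : measurable_fun setT ratio.
    apply: measurable_funM; first apply: measurable_funM.
    - exact: measurableT_comp.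
    - apply: measurable_inv_ge0 => [|z]; last exact: density_ge0.
      apply: (measurableT_comp (measurable_density dom0)).
      by do 2 (apply: measurableT_comp => //).
    - apply: measurable_inv_ge0 => [|z]; last exact: density_ge0.
      apply: (measurableT_comp (measurable_density dom1)).
      by do 2 (apply: measurableT_comp => //).
  have ratio0 z : (0 <= ratio z)%R by rewrite !divr_ge0 ?density_ge0.
  have mrp : measurable_fun setT (fun z => ratio z * p z.1)%R.
    by apply: measurable_funM => //; exact: (measurableT_comp mp measurable_fst).
  have rp0 z : (0 <= ratio z * p z.1)%R by rewrite mulr_ge0// fine_ge0.
  have rp1 : \int[Q]_z (ratio z * p z.1)%:E <= 1.
    under eq_integral => z _ do rewrite EFinM.
    apply: (le_trans (Qint (fun z => (ratio z)%:E) _ _)).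
    - exact/measurable_EFinP.
    - by move=> z; rewrite lee_fin.
    - apply: integral_ratio => //.
      have := ge0_integral_density dom' (f := cst 1) (measurable_cst _) (fun=> lee01).
      rewrite integral_probability_cst => ->.
      by under [leRHS]eq_integral => z _ do rewrite mul1e.
  have irp : Q.-integrable setT (fun z => (ratio z * p z.1)%:E).
    by apply: ge0_integrable_lty => //; rewrite (le_lt_trans rp1)// ltry.
  have lnp0 z : (0 <= ln (p z)^-1)%R.
    have [->|pz] := eqVneq (p z) 0%R; first by rewrite invr0 ln0.
    rewrite ln_ge0// invf_ge1 ?lt0r ?pz ?fine_ge0//.
    have mKz := mK (K z).
    by rewrite -lee_fin fineK ?fin_num_measure// probability_le1.
  have entA := fiber_entropy_le hu r01 (coupling_moment2_add cg M0P M1P).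
  have iA : g.-integrable setT (fun z => (A z)%:E).
    apply: ge0_integrable_lty => //; first exact/measurable_EFinP.
    by rewrite (le_lt_trans entA)// ltry.
  have i0 : mu0.-integrable setT (fun x => (ln (rho0 x))%:E).
    apply: (integral_EFin_integrable (r := h0)); last by rewrite -entropyE.
    by apply/measurable_EFinP/measurableT_comp => //; exact: measurable_density.
  have i1 : mu1.-integrable setT (fun x => (ln (rho1 x))%:E).
    apply: (integral_EFin_integrable (r := h1)); last by rewrite -entropyE.
    by apply/measurable_EFinP/measurableT_comp => //; exact: measurable_density.
  have ig0 := coupling_integrable_fst cQ (coupling_integrable_fst cg i0).
  have ig1 := coupling_integrable_snd cQ (coupling_integrable_snd cg i1).
  have iQA := coupling_integrable_fst cQ iA.
  have iC c : Q.-integrable setT (cst c%:E) by exact: finite_measure_integrable_cst.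
  pose U (z : Z * Z) : \bar R := (A z.1)%:E + (ln (rho0 z.1.1))%:E +
    (ln (rho1 z.2.2))%:E + (ratio z * p z.1)%:E + cst (-1)%:E z.
  have iU1 := integrableD measurableT iQA ig0.
  have iU2 := integrableD measurableT iU1 ig1.
  have iU3 := integrableD measurableT iU2 irp.
  have iU := integrableD measurableT iU3 (iC (-1)%R).
  have mlnrho : measurable_fun setT (fun z => (ln (rho z))%:E : \bar R).
    exact/measurable_EFinP/measurableT_comp.
  rewrite g'E//; apply: (@le_trans _ _ (\int[Q]_z U z)).
    apply: ae_le_integral; [exact: (measurableT_comp mlnrho mphi)| |].
      exact: (measurable_int Q iU).
    have p_gt0 := coupling_ae_fst cQ (ae_fiber_gt0 mK g).
    have rho_gt0 : {ae Q, forall z, (0 < rho (phi z))%R}.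
      exact: (ae_image (phi := phi) (P := Q) (Q := g')
        (E := fun z => (0 < rho z)%R) mphi g'E (density_gt0 dom')).
    have rho0_gt0 := coupling_ae_fst cQ (coupling_ae_fst cg (density_gt0 dom0)).
    have rho1_gt0 := coupling_ae_snd cQ (coupling_ae_snd cg (density_gt0 dom1)).
    near=> z.
    have pz : (0 < p z.1)%R by near: z; exact: p_gt0.
    have rhoz : (0 < rho (phi z))%R by near: z; exact: rho_gt0.
    have rho0z : (0 < rho0 z.1.1)%R by near: z; exact: rho0_gt0.
    have rho1z : (0 < rho1 z.2.2)%R by near: z; exact: rho1_gt0.
    have ratioz : (0 < ratio z)%R by rewrite !divr_gt0.
    rewrite /U -!EFinD lee_fin.
    have h : (-1 < ratio z * p z.1 - 1)%R by rewrite ltrBDr addNr mulr_gt0.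
    have := le_ln1Dx h; rewrite [(1 + _)%R]addrC subrK.
    rewrite lnM ?posrE// /ratio !ln_div ?posrE ?divr_gt0//.
    by rewrite /A lnV ?posrE// -/(ratio z) /cst; lra.
  rewrite /U integralD// integralD// integralD// integralD//.
  rewrite integral_probability_cst.
  rewrite (coupling_integral_fst cQ (f := fun z => (A z)%:E))//.
  rewrite (coupling_integral_fst cQ (f := fun z => (ln (rho0 z.1))%:E)); last first.
    exact: measurable_int (coupling_integrable_fst cg i0).
  rewrite (coupling_integral_snd cQ (f := fun z => (ln (rho1 z.2))%:E)); last first.
    exact: measurable_int (coupling_integrable_snd cg i1).
  rewrite (coupling_integral_fst cg (f := fun x => (ln (rho0 x))%:E)); last first.
    exact: measurable_int i0.
  rewrite (coupling_integral_snd cg (f := fun x => (ln (rho1 x))%:E)); last first.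
    exact: measurable_int i1.
  rewrite -!entropyE// h0P h1P.
  set B := (d%:R * _ + _ + _ + _)%R.
  rewrite (_ : (B + h0 + h1)%:E = B%:E + h0%:E + h1%:E + 1 + (-1)%:E); last first.
    by rewrite -!EFinD; congr EFin; lra.
  by rewrite leeD2r// leeD// leeD2r// leeD2r.
Unshelve. all: by end_near.
Qed.

End competitor.

(** * Entropy near a monotone plan *)

Lemma ae_forall_countable d (T : measurableType d) (R : realType)
    (mu : {measure set T -> \bar R}) (I : countType) (P : I -> T -> Prop) :
  (forall i, {ae mu, forall x, P i x}) -> {ae mu, forall x, forall i, P i x}.
Proof.
move=> H; have : {ae mu, forall x, forall n, if unpickle n is Some i then P i x else True}.
  apply: ae_foralln => n; case: (unpickle n) => [i|]; first exact: H.
  by apply: aeW.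
by apply: filterS => x Hx i; have := Hx (pickle i); rewrite pickleK.
Qed.

Lemma ae_product_sections d1 d2 (T1 : measurableType d1) (T2 : measurableType d2)
    (R : realType) (m1 : {measure set T1 -> \bar R})
    (m2 : {sigma_finite_measure set T2 -> \bar R}) (P : T1 * T2 -> Prop) :
  {ae (m1 \x m2)%E, forall z, P z} ->
  {ae m1, forall x, {ae m2, forall y, P (x, y)}}.
Proof.
move=> [N [mN N0 PN]].
have mx := measurable_fun_xsection m2 mN.
have : \int[m1]_x `|m2 (xsection N x)| = 0.
  by rewrite -[RHS]N0; apply: eq_integral => x _; rewrite gee0_abs.
move=> /(ae_eq_integral_abs m1 measurableT mx).1.
apply: filterS => x /(_ I)/= x0; exists (xsection N x); split => //.
  exact: measurable_xsection.
by move=> y Py; rewrite /xsection/= inE; exact: PN.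
Qed.

Section monotone_graph.
Context {R : realType} (d : nat).
Local Notation Rd := ('rV[R]_d).
Local Notation Z := (Rd * Rd)%type.
Variables (g : probability Z R) (r : R).
Hypothesis r0 : (0 < r)%R.
Hypothesis mono : {ae (g \x g)%E, forall z, (0 <= exchange_gain z)%R}.

(** A set carrying a monotone plan is, in the coordinates [(x + y, x)], the
    graph of a map which does not increase distances (Minty).  It is replaced
    by a map constant on the cells of [x + y]: in each cell, the value is that
    of a generic point of the plan whose sum is nearly as close as possible to
    a reference point of the cell. *)
Lemma monotone_plan_graph : exists S : Rd -> Rd,
  measurable_fun setT S /\
  {ae g, forall z', forall z : Z,
    (edot (z.1 - S (z.1 + z.2)) (z.1 - S (z.1 + z.2)) <=
     34 * (edot (z.1 - z'.1) (z.1 - z'.1) + edot (z.2 - z'.2) (z.2 - z'.2)) +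
     (16 * d%:R + 4) * r ^+ 2)%R}.
Proof.
pose good (z : Z) := {ae g, forall z', (0 <= exchange_gain (z, z'))%R}.
have good_ae : {ae g, forall z, good z} by exact: (ae_product_sections mono).
have [zg good_zg] : exists z, good z.
  apply: contrapT => /forallNP nogood.
  have [N [mN N0 gN]] := good_ae.
  have : g setT <= g N by apply: le_measure; rewrite ?inE// => z _; apply: gN; exact: nogood.
  by rewrite [X in _ <= X]N0 probability_setT lee_fin ler10.
(* the corner of a cell serves as its reference point *)
pose c (k : 'rV[int]_d) : Rd := (\row_i (r * (k ord0 i)%:~R))%R.
have cK k : cell_index r (c k) = k.
  apply/rowP => i; rewrite !mxE mulrAC divff ?gt_eqF// mul1r.
  exact: intrKfloor.
pose dist (z : Z) k := edot (z.1 + z.2 - c k)%R (z.1 + z.2 - c k)%R.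
have near_min k : exists z, good z /\
    forall z', good z' -> (dist z k <= dist z' k + r ^+ 2)%R.
  pose E := [set dist z k | z in good].
  have Einf : has_inf E.
    split; first by exists (dist zg k), zg.
    by exists 0%R => _ [z _ <-]; exact: edot_ge0.
  have r20 : (0 < r ^+ 2)%R by rewrite exprn_gt0.
  have [_ [z gz <-] dz] := inf_adherent r20 Einf.
  exists z; split => // z' gz'; apply: (le_trans (ltW dz)); rewrite lerD2r.
  by apply: ge_inf; [exact: Einf.2|exists z'].
have [zz zzP] := choice near_min.
exists (fun w => (zz (cell_index r w)).1); split.
  exact: (measurable_fun_countable (fun k => measurable_cell k r0) (fun k => (zz k).1)).
have zz_ae : {ae g, forall z', forall k, (0 <= exchange_gain (zz k, z'))%R}.
  by apply: ae_forall_countable => k; exact: (zzP k).1.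
apply: filterS2 good_ae zz_ae => z' good_z' zz_z' z.
set w := (z.1 + z.2)%R; set k := cell_index r w.
have h1 : (dist (zz k) k <= dist z' k + r ^+ 2)%R := (zzP k).2 z' good_z'.
have h2 : (edot (w - c k) (w - c k) <= d%:R * r ^+ 2)%R.
  by apply: cell_diam => //; rewrite cK.
have h3 : (dist z' k <= 2 * edot (z'.1 + z'.2 - w) (z'.1 + z'.2 - w) +
    2 * edot (w - c k) (w - c k))%R.
  have := edot_add_le (z'.1 + z'.2 - w) (w - c k).
  by rewrite addrA subrK.
have h4 : (edot (z'.1 + z'.2 - w) (z'.1 + z'.2 - w) <=
    2 * edot (z.1 - z'.1) (z.1 - z'.1) + 2 * edot (z.2 - z'.2) (z.2 - z'.2))%R.
  have := edot_add_le (z'.1 - z.1) (z'.2 - z.2).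
  rewrite -(opprB z.1) -(opprB z.2) !edotNl !edotNr !opprK /w => h.
  rewrite (_ : (z'.1 + z'.2 - (z.1 + z.2) = - (z.1 - z'.1) - (z.2 - z'.2))%R)//.
  by rewrite !opprB opprD addrACA.
have h5 : (edot (z'.1 - (zz k).1) (z'.1 - (zz k).1) <=
    edot (z'.1 + z'.2 - ((zz k).1 + (zz k).2)) (z'.1 + z'.2 - ((zz k).1 + (zz k).2)))%R.
  rewrite opprD addrACA; apply: edot_le_add.
  have := zz_z' k; rewrite /exchange_gain/=.
  by rewrite -(opprB z'.1) -(opprB z'.2) edotNl edotNr opprK.
have h6 : (edot (z'.1 + z'.2 - ((zz k).1 + (zz k).2))
      (z'.1 + z'.2 - ((zz k).1 + (zz k).2)) <=
    2 * dist z' k + 2 * dist (zz k) k)%R.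
  have := edot_add_le (z'.1 + z'.2 - c k) (- ((zz k).1 + (zz k).2 - c k)).
  by rewrite opprB addrA subrK -(opprB (_ + _) (c k)) edotNl edotNr opprK.
have h7 : (edot (z.1 - (zz k).1) (z.1 - (zz k).1) <=
    2 * edot (z.1 - z'.1) (z.1 - z'.1) + 2 * edot (z'.1 - (zz k).1) (z'.1 - (zz k).1))%R.
  have := edot_add_le (z.1 - z'.1) (z'.1 - (zz k).1).
  by rewrite addrA subrK.
have h8 := edot_ge0 (z.2 - z'.2).
lra.
Qed.

End monotone_graph.

Section entropy_lower_bound.
Context {R : realType} (d : nat).
Local Notation Rd := ('rV[R]_d).
Local Notation Z := (Rd * Rd)%type.
Local Notation leb := (lebesgue_rV d).
Local Notation leb2 := (sigma_finite_prod (lebesgue_rV d) (lebesgue_rV d)).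

Lemma ln_gaussian (m x : Rd) (s : R) : (0 < s)%R ->
  ln (gaussian m s x) = (- (d%:R * (ln (Num.sqrt (2 * pi)) + ln s)) -
    (2 * s ^+ 2)^-1 * edot (x - m) (x - m))%R.
Proof.
move=> s0; rewrite gaussianE//.
have a0 : (0 < Num.sqrt (2 * pi) :> R)%R by rewrite sqrtr_gt0 mulr_gt0// pi_gt0.
have -> : (Num.sqrt (2 * pi * s ^+ 2) = Num.sqrt (2 * pi) * s)%R.
  by rewrite sqrtrM ?mulr_ge0 ?pi_ge0// sqrtr_sqr gtr0_norm.
rewrite lnM ?posrE ?expR_gt0 ?invr_gt0 ?exprn_gt0 ?mulr_gt0// expRK.
rewrite lnV ?posrE ?exprn_gt0 ?mulr_gt0// lnXn ?mulr_gt0// lnM ?posrE//.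
by rewrite -mulr_natl; ring.
Qed.

Lemma gaussian_gt0 (m x : Rd) (s : R) : (0 < s)%R -> (0 < gaussian m s x)%R.
Proof.
move=> s0; rewrite gaussianE// mulr_gt0 ?expR_gt0// invr_gt0 exprn_gt0//.
by rewrite sqrtr_gt0 !mulr_gt0 ?pi_gt0 ?exprn_gt0.
Qed.

Section graph_density.
Variables (S : Rd -> Rd) (s : R).
Hypotheses (mS : measurable_fun setT S) (s0 : (0 < s)%R).

(** A Gaussian thickening of width [s] of the graph of [S] in the coordinates
    [(x + y, x)]. *)
Definition graph_density (z : Z) : R :=
  (gaussian 0 1 (z.1 + z.2) * gaussian (S (z.1 + z.2)) s z.1)%R.

Lemma measurable_graph_density : measurable_fun setT graph_density.
Proof.
have mw : measurable_fun setT (fun z : Z => z.1 + z.2)%R by exact: measurable_rVD.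
apply: measurable_funM; apply: measurable_gaussian => //.
exact: measurableT_comp.
Qed.

Lemma graph_density_gt0 z : (0 < graph_density z)%R.
Proof. by rewrite mulr_gt0// gaussian_gt0. Qed.

(** The map [(x, y) |-> (x + y, x)] preserves Lebesgue measure. *)
Lemma integral_graph_density : \int[leb2]_z (graph_density z)%:E = 1.
Proof.
pose H (z : Z) : \bar R := (gaussian 0 1 z.2 * gaussian (S z.2) s z.1)%:E.
have mH : measurable_fun setT H.
  apply/measurable_EFinP/measurable_funM; apply: measurable_gaussian => //.
  exact: measurableT_comp.
have H0 z : 0 <= H z by rewrite lee_fin mulr_ge0// gaussian_ge0.
rewrite /sigma_finite_prod.
rewrite (fubini_tonelli1 (fun z => (graph_density z)%:E)); last 2 first.
- by apply/measurable_EFinP; apply: measurable_graph_density.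
- by move=> z; rewrite lee_fin ltW// graph_density_gt0.
transitivity (\int[leb]_x \int[leb]_w H (x, w)).
  apply: eq_integral => x _; rewrite /fubini_F.
  rewrite -(ge0_integral_lebesgue_rVD x (f := fun w => H (x, w))).
  - by apply: eq_integral => y _; rewrite /graph_density /H/= (addrC y x).
  - exact: measurable_fun_pair2.
  - by [].
rewrite (fubini_tonelli H)// -(integral_gaussian (0 : Rd) (@ltr01 R)).
apply: eq_integral => w _.
transitivity (\int[leb]_x ((gaussian 0 1 w)%:E * (gaussian (S w) s x)%:E)).
  by apply: eq_integral => x _.
rewrite ge0_integralZl//.
- by rewrite integral_gaussian// mule1.
- by apply/measurable_EFinP; apply: measurable_gaussian.
- by move=> x _; rewrite lee_fin gaussian_ge0.
- by rewrite lee_fin gaussian_ge0.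
Qed.

End graph_density.

Variables (mu0 mu1 : probability Rd R) (ga g0 : probability Z R) (M0 M1 s : R).
Variable p : probability (Z * Z)%type R.
Hypotheses (cga : is_coupling mu0 mu1 ga) (cp : is_coupling ga g0 p).
Hypothesis (M0P : \int[mu0]_x (edot x x)%:E <= M0%:E).
Hypothesis (M1P : \int[mu1]_x (edot x x)%:E <= M1%:E).
Hypothesis mono : {ae (g0 \x g0)%E, forall z, (0 <= exchange_gain z)%R}.
Hypothesis s0 : (0 < s)%R.
Hypothesis ps : \int[p]_w (enorm2 (w.1 - w.2) ^+ 2)%:E <= (s ^+ 2)%:E.

(** The Gibbs inequality against the thickening of width [s] of the graph which
    carries [g0]. A point of [ga] is, in quadratic mean, at distance of order [s]
    from this graph, so that the Gaussian exponent contributes a constant and the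
    normalization of the [d] transverse directions contributes [- d * ln s]. *)
Lemma entropy_near_monotone_ge :
  (- (2 * d%:R * ln (Num.sqrt (2 * pi)) + (M0 + M1) + 19 + 8 * d%:R +
      d%:R * ln s))%:E <= entropy leb2 ga.
Proof.
have [S [mS Sp]] := monotone_plan_graph s0 mono.
have s20 : (0 < s ^+ 2)%R by rewrite exprn_gt0.
have mw : measurable_fun setT (fun z : Z => z.1 + z.2)%R by exact: measurable_rVD.
pose W (z : Z) := edot (z.1 + z.2)%R (z.1 + z.2)%R.
pose V (z : Z) := edot (z.1 - S (z.1 + z.2))%R (z.1 - S (z.1 + z.2))%R.
have mW : measurable_fun setT W by exact: measurable_edot.
have mV : measurable_fun setT V.
  by apply: measurable_edot; apply: measurable_rVB => //; exact: measurableT_comp.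
have W0 z : (0 <= W z)%R by exact: edot_ge0.
have V0 z : (0 <= V z)%R by exact: edot_ge0.
have WM : \int[ga]_z (W z)%:E <= (2 * M0 + 2 * M1)%:E.
  exact: coupling_moment2_add cga M0P M1P.
have md2 : measurable_fun setT (fun w : Z * Z => enorm2 (w.1 - w.2) ^+ 2)%R.
  under eq_fun do rewrite sqr_enorm2.
  by apply: measurable_funD; apply: measurable_edot; apply: measurable_rVB;
    do 2 (apply: measurableT_comp => //).
(* 38 + 16 d = 34 + (16 d + 4): the cells have the size s of the thickening *)
have VM : \int[ga]_z (V z)%:E <= ((38 + 16 * d%:R) * s ^+ 2)%:E.
  rewrite -(coupling_integral_fst cp (f := fun z => (V z)%:E)); last exact/measurable_EFinP.
  apply: (@le_trans _ _ (\int[p]_w (34%:E * (enorm2 (w.1 - w.2) ^+ 2)%:E +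
      cst ((16 * d%:R + 4) * s ^+ 2)%:E w))).
    apply: ae_le_integral.
    - by apply/measurable_EFinP; exact: (measurableT_comp mV measurable_fst).
    - apply: emeasurable_funD => //; apply: emeasurable_funM => //.
      exact/measurable_EFinP.
    apply: filterS (coupling_ae_snd cp Sp) => w /(_ w.1) Vw.
    by rewrite /cst -EFinM -EFinD lee_fin sqr_enorm2.
  rewrite ge0_integralD//; last 3 first.
  - by move=> w _; rewrite mule_ge0// lee_fin sqr_ge0.
  - by apply: emeasurable_funM => //; exact/measurable_EFinP.
  - by move=> w _; rewrite lee_fin mulr_ge0 ?addr_ge0 ?mulr_ge0// ltW.
  rewrite integral_probability_cst ge0_integralZl//; last 2 first.
  - exact/measurable_EFinP.
  - by move=> w _; rewrite lee_fin sqr_ge0.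
  rewrite (_ : ((38 + 16 * d%:R) * s ^+ 2)%:E =
    34%:E * (s ^+ 2)%:E + ((16 * d%:R + 4) * s ^+ 2)%:E).
    by rewrite leeD2r// lee_wpmul2l.
  by rewrite -EFinM -EFinD; congr EFin; ring.
pose q := graph_density S s.
have mq : measurable_fun setT q by exact: measurable_graph_density.
pose F z := (2^-1 * W z + (2 * s ^+ 2)^-1 * V z)%R.
pose c := (- (2 * d%:R * ln (Num.sqrt (2 * pi)) + d%:R * ln s) : R)%R.
have lnq z : ln (q z) = (c - F z)%R.
  rewrite /q /graph_density lnM ?posrE ?gaussian_gt0// !ln_gaussian//.
  by rewrite ln1 expr1n subr0 mulr1 /c /F /W /V; ring.
have mF : measurable_fun setT F.
  by apply: measurable_funD; apply: measurable_funM.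
have F0 z : (0 <= F z)%R.
  by rewrite addr_ge0// mulr_ge0// invr_ge0 mulr_ge0// ltW.
have FM : \int[ga]_z (F z)%:E <= (M0 + M1 + (19 + 8 * d%:R))%:E.
  under eq_integral => z _ do rewrite /F EFinD !EFinM.
  rewrite ge0_integralD//; last 4 first.
  - by move=> z _; rewrite mule_ge0// lee_fin.
  - by apply: emeasurable_funM => //; exact/measurable_EFinP.
  - by move=> z _; rewrite mule_ge0// lee_fin// invr_ge0 mulr_ge0// ltW.
  - by apply: emeasurable_funM => //; exact/measurable_EFinP.
  rewrite !ge0_integralZl//.
  - rewrite (_ : (M0 + M1 + (19 + 8 * d%:R))%:E = (2^-1)%:E * (2 * M0 + 2 * M1)%:E +
      (2 * s ^+ 2)^-1%:E * ((38 + 16 * d%:R) * s ^+ 2)%:E).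
      by rewrite leeD// lee_wpmul2l// lee_fin invr_ge0 mulr_ge0// ltW.
    rewrite -!EFinM -EFinD; congr EFin; field.
    by rewrite gt_eqF.
  - exact/measurable_EFinP.
  - by move=> z _; rewrite lee_fin.
  - by rewrite lee_fin invr_ge0 mulr_ge0// ltW.
  - exact/measurable_EFinP.
  - by move=> z _; rewrite lee_fin.
have iF : ga.-integrable setT (fun z => (F z)%:E).
  by apply: ge0_integrable_lty => //; rewrite (le_lt_trans FM)// ltry.
have iC : ga.-integrable setT (cst c%:E) by exact: finite_measure_integrable_cst.
have icF : ga.-integrable setT (fun z => (ln (q z))%:E).
  rewrite (_ : (fun z => _) = (cst c%:E \- (fun z => (F z)%:E))).
    exact: integrableB.
  by apply/funext => z; rewrite lnq EFinB.
have q1 : \int[leb2]_z (q z)%:E <= 1 by rewrite integral_graph_density.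
have [dom|ndom] := pselect (ga `<< leb2); last first.
  by rewrite /entropy asboolF// leey.
have gib : \int[ga]_z (ln (q z))%:E <= entropy leb2 ga.
  by apply: gibbs => // z; exact: graph_density_gt0.
apply: le_trans gib.
under eq_integral => z _ do rewrite lnq EFinB.
rewrite (integralB measurableT iC iF) integral_probability_cst.
apply: (@le_trans _ _ (c%:E - (M0 + M1 + (19 + 8 * d%:R))%:E)).
  by rewrite -EFinB lee_fin /c; lra.
by rewrite leeB.
Qed.

End entropy_lower_bound.

(** * Quadratic detachment from a Lipschitz Brenier map *)

Section convex_gradient.
Local Open Scope ring_scope.
Context {R : realType} (d : nat).
Local Notation Rd := ('rV[R]_d).
Variables (f : Rd -> R^o).
Hypothesis cf : convex_function [set: convex_lmodType Rd] f.

(** The slopes of [f] from [x] towards [y] are at most [f y - f x] by convexity,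
    and so is their limit at [x]. *)
Lemma convex_gradient_ge x v y : is_gradient f x v ->
  f x + edot v (y - x) <= f y.
Proof.
move=> [df fv].
have dv : derivable f x (y - x) by exact: diff_derivable.
have : 'D_(y - x) f x <= f y - f x.
  rewrite /derive cvg_at_rightE//.
  apply: limr_le.
    by apply/cvg_ex; exists ('D_(y - x) f x); exact: cvg_dnbhs_at_right.
  near=> t.
  have t0 : 0 < t by [].
  have t1 : t <= 1 by near: t; exact: nbhs_right_le.
  pose T : {i01 R} := (Itv01 (ltW t0) t1).
  have := @cf T y x (mem_set I) (mem_set I).
  rewrite convRE /= => h.
  rewrite -[_ <= _]/(t^-1 * (f (t *: (y - x) + x) - f x) <= f y - f x).
  rewrite mulrC ler_pdivrMr//.
  rewrite (_ : t *: (y - x) + x = t *: y + (1 - t) *: x); last first.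
    by rewrite scalerBr scalerBl scale1r addrAC -addrA (addrC x).
  rewrite -[X in X - _ <= _]/(f (conv T (y : convex_lmodType Rd) (x : convex_lmodType Rd))).
  move: h; rewrite /unstable.onem; lra.
by rewrite deriveE// fv; lra.
Unshelve. all: by end_near.
Qed.

Variables (T : Rd -> Rd) (L : R).
Hypotheses (L0 : 0 < L) (LT : elipschitz L T).

Lemma edot_elipschitz x y : edot (T x - T y) (x - y) <= L * edot (x - y) (x - y).
Proof.
have := LT x y; rewrite -ler_sqr ?nnegrE ?mulr_ge0 ?sqrtr_ge0 ?(ltW L0)//.
rewrite exprMn !sqr_enorm => h.
have := edot_le_young (T x - T y) (x - y) L0.
have : L^-1 * edot (T x - T y) (T x - T y) <= L * edot (x - y) (x - y).
  by rewrite mulrC ler_pdivrMr// mulrAC -expr2.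
lra.
Qed.

(** The supporting plane at [y] bounds [f y - f x] by [edot (T y) (y - x)]. This
    uses the gradient at the end points only, which are in the set of full
    measure where [f] is differentiable; the price is [L] instead of [L / 2]. *)
Lemma convex_gradient_le x y : is_gradient f x (T x) -> is_gradient f y (T y) ->
  f y <= f x + edot (T x) (y - x) + L * edot (y - x) (y - x).
Proof.
move=> gx gy; have := convex_gradient_ge x gy; have := edot_elipschitz y x.
rewrite -(opprB y x) edotNr edotDl edotNl; lra.
Qed.

End convex_gradient.

Section dense_sequence.
Context {R : realType} (d : nat).
Local Notation Rd := ('rV[R]_d).

(** Every cube has positive measure, hence contains a point of [G]; one such
    point is chosen for each index of a cube and each mesh [1 / (n + 1)]. *)
Lemma ae_dense_sequence (G : Rd -> Prop) : {ae lebesgue_rV d, forall x, G x} ->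
  exists X : nat -> Rd, (forall n, G (X n)) /\
    forall x (e : R), (0 < e)%R -> exists n, (edot (X n - x) (X n - x) <= e)%R.
Proof.
move=> [N [mN N0 GN]].
have cellG (kn : 'rV[int]_d * nat) : exists x,
    G x /\ cell_index (kn.2.+1%:R^-1)%R x = kn.1.
  have r0 : (0 < kn.2.+1%:R^-1 :> R)%R by rewrite invr_gt0.
  apply: contrapT => /forallNP nG.
  have mC := measurable_cell kn.1 r0.
  have : lebesgue_rV d (cell_index (kn.2.+1%:R^-1)%R @^-1` [set kn.1]) <=
      lebesgue_rV d N.
    apply: le_measure; rewrite ?inE// => x xk; apply: GN => Gx.
    exact: (nG x).
  rewrite lebesgue_cell// [X in _ <= X]N0 lee_fin leNgt.
  by rewrite exprn_gt0.
have [X XP] := choice cellG.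
pose Y n := if unpickle n is Some i then X i else X (0%R, 0%N).
exists Y; split=> [n|x e e0].
  by rewrite /Y; case: unpickle => [i|]; exact: (XP _).1.
have [n ne] : exists n, (d%:R * (n.+1%:R^-1) ^+ 2 <= e)%R.
  have [n /ltW nP] : exists n, (d%:R / e < n.+1%:R)%R.
    by exists (Num.truncn (d%:R / e)); exact: truncnS_gt.
  exists n; rewrite exprVn -ler_pdivlMr ?invr_gt0 ?exprn_gt0// invrK.
  rewrite -ler_pdivrMl// mulrC (le_trans nP)// expr2 ler_peMr// ler1n//.
exists (pickle (cell_index (n.+1%:R^-1)%R x, n)); apply: le_trans ne.
apply: cell_diam; first by rewrite invr_gt0.
by rewrite /Y pickleK; exact: (XP (cell_index (n.+1%:R^-1)%R x, n)).2.
Qed.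

End dense_sequence.

Section detachment.
Context {R : realType} (d : nat).
Local Notation Rd := ('rV[R]_d).
Local Notation Z := (Rd * Rd)%type.
Variables (mu0 mu1 : probability Rd R) (T : Rd -> Rd) (L M0 M1 : R).
Hypothesis dom0 : mu0 `<< lebesgue_rV d.
Hypothesis (M0P : \int[mu0]_x (edot x x)%:E <= M0%:E).
Hypothesis (M1P : \int[mu1]_x (edot x x)%:E <= M1%:E).
Hypotheses (L0 : (0 < L)%R) (LT : elipschitz L T).
Hypothesis TP : is_brenier_map mu0 mu1 T.

Lemma brenier_integral (h : Rd -> \bar R) : measurable_fun setT h ->
  \int[mu0]_x h (T x) = \int[mu1]_y h y.
Proof.
move=> mh; have [mT Tmu _ _] := TP.
have [Q [QE <-//]] := probability_image mu0 mT.
by apply: eq_measure_integral => A mA _; apply: etrans (QE A) _; exact: Tmu.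
Qed.

Lemma integrable_brenier : mu0.-integrable setT (fun x => (edot (T x) (T x))%:E).
Proof.
have [mT _ _ _] := TP.
apply: ge0_integrable_lty; first exact: measurable_edot.
  by move=> x; exact: edot_ge0.
rewrite (brenier_integral (h := fun y => (edot y y)%:E)); last first.
  by apply/measurable_EFinP; exact: measurable_edot.
by rewrite (le_lt_trans M1P)// ltry.
Qed.

(** Here [fs] is the convex conjugate of the potential [f], as a supremum along a
    dense sequence of points of differentiability. There
    [fs (T x) = edot x (T x) - f x], so the right-hand side of the inequality is
    [f z.1 + fs z.2]. As [f] grows at most quadratically with constant [L], its
    conjugate separates from its supporting planes at least quadratically: this
    is the Fenchel-Young inequality with a remainder. *)
Lemma brenier_conjugate : exists fs : Rd -> R,
  [/\ measurable_fun setT fs,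
      mu1.-integrable setT (fun y => (fs y)%:E) &
      forall g : probability Z R, is_coupling mu0 mu1 g ->
        {ae g, forall z : Z, (edot z.1 z.2 +
           (4 * L)^-1 * edot (z.2 - T z.1) (z.2 - T z.1) <=
           edot z.1 (T z.1) - fs (T z.1) + fs z.2)%R}].
Proof.
have [mT Tmu _ [f cvf gradf]] := TP.
have [X [gX denseX]] := ae_dense_sequence gradf.
pose G x := is_gradient f x (T x).
pose v n y : \bar R := (edot (X n) y - f (X n))%:E.
pose conj y := esups (v ^~ y) 0%N.
have mv n : measurable_fun setT (v n).
  apply/measurable_EFinP/measurable_funB => //.
  exact: (measurable_edot (f := cst (X n)) (g := id)).
have mconj : measurable_fun setT conj by exact: measurable_fun_esups.
have conj_ge n y : v n y <= conj y.
  by apply: ereal_sup_ubound; exists n.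
have conj_le y C : (forall n, v n y <= C) -> conj y <= C.
  by move=> vC; apply: ge_ereal_sup => _ [n _ <-].
have conjT x : G x -> conj (T x) = (edot x (T x) - f x)%:E.
  move=> Gx; apply/eqP; rewrite eq_le; apply/andP; split.
    apply: conj_le => n; rewrite lee_fin.
    have := convex_gradient_ge cvf (X n) Gx.
    by rewrite (edotDr _ _ (T x)) (edotNr _ (T x)) (edotC (T x) x) (edotC (T x) (X n)); lra.
  apply/lee_addgt0Pr => e e0.
  have [n Xn] := denseX x (e / L)%R (divr_gt0 e0 L0).
  apply: (@le_trans _ _ (v n (T x) + e%:E)); last by rewrite leeD2r.
  rewrite -EFinD lee_fin.
  have := convex_gradient_le cvf L0 LT Gx (gX n).
  have : (L * edot (X n - x) (X n - x) <= e)%R by rewrite mulrC -ler_pdivlMr.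
  by rewrite (edotDr _ _ (T x)) (edotNr _ (T x)) (edotC (T x) x) (edotC (T x) (X n)); lra.
have G0 : {ae mu0, forall x, G x} by exact: null_dominates_ae dom0 gradf.
pose fs y := fine (conj y).
have mfs : measurable_fun setT fs by exact: measurableT_comp.
have fsT x : G x -> fs (T x) = (edot x (T x) - f x)%R.
  by move=> Gx; rewrite /fs conjT.
exists fs; split => //.
  apply/integrableP; split; first exact/measurable_EFinP.
  have msq : measurable_fun setT (fun y : Rd => `|(fs y)%:E|).
    by apply: measurableT_comp => //; exact/measurable_EFinP.
  rewrite -brenier_integral//.
  pose A := (`|f (X 0%N)| + 2^-1 * edot (T (X 0%N)) (T (X 0%N)) +
    (1 + 2 * L) * edot (X 0%N) (X 0%N))%R.
  pose h x := ((A%:E + (3 / 2 + 2 * L)%:E * (edot x x)%:E) +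
    (2^-1)%:E * (edot (T x) (T x))%:E).
  have ih : mu0.-integrable setT h.
    apply: integrableD => //; last exact/integrableZl/integrable_brenier.
    apply: integrableD => //; first exact: finite_measure_integrable_cst.
    apply: integrableZl => //; exact: integrable_moment2 M0P.
  apply: le_lt_trans (integrable_lty measurableT ih).
  apply: ae_le_integral; [exact: (measurableT_comp msq mT)|exact: (measurable_int _ ih)|].
  apply: filterS G0 => x Gx; rewrite fsT// /h -!EFinM -!EFinD lee_fin.
  have k1 := convex_gradient_ge cvf x (gX 0%N).
  have k2 := convex_gradient_le cvf L0 LT (gX 0%N) Gx.
  have k3 := edot_add_le x (- X 0%N); rewrite edotNl edotNr opprK in k3.
  have k3' : (L * edot (x - X 0%N) (x - X 0%N) <=
      L * (2 * edot x x + 2 * edot (X 0%N) (X 0%N)))%R by rewrite ler_wpM2l// ltW.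
  have k4 := edot_le_young (T (X 0%N)) (x - X 0%N) (@ltr01 R).
  have k5 := edot_le_young (- T (X 0%N)) (x - X 0%N) (@ltr01 R).
  rewrite !edotNl edotNr opprK in k5.
  have k6 := edot_le_young x (T x) (@ltr01 R).
  have k7 := edot_le_young (- x) (T x) (@ltr01 R).
  rewrite !edotNl edotNr opprK in k7.
  have k8 := ler_norm (f (X 0%N)); have k9 := ler_norm (- f (X 0%N)).
  rewrite normrN in k9; rewrite invr1 !mul1r in k4 k5 k6 k7.
  have k10 := edot_ge0 (X 0%N).
  by rewrite ler_norml /A; apply/andP; split; lra.
move=> g cg.
have conj_fin : {ae mu1, forall y, conj y < +oo}.
  have mS : measurable [set y | conj y = +oo].
    by rewrite -[X in measurable X]setTI; exact: (mconj measurableT _ (emeasurable_set1 +oo)).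
  exists [set y | conj y = +oo]; split => //.
    have <- := Tmu _ mS; have [N [mN N0 GN]] := G0.
    apply: subset_measure0 N0 => //.
      by rewrite -[X in measurable X]setTI; exact: (mT measurableT _ mS).
    by move=> x /= Tx; apply: GN => Gx; move: Tx; rewrite conjT.
  by move=> y /= /negP; rewrite -leNgt leye_eq => /eqP.
apply: filterS2 (coupling_ae_fst cg G0) (coupling_ae_snd cg conj_fin).
move=> [x y] /= Gx yoo; rewrite fsT//.
have conjE : conj y = (fs y)%:E.
  rewrite /fs fineK// fin_numE (lt_eqF yoo) andbT.
  by apply/eqP => Ey; have := conj_ge 0%N y; rewrite Ey.
set a := (y - T x)%R.
suff : forall e, (0 < e)%R -> (edot x y + (4 * L)^-1 * edot a a <=
    f x + fs y + e)%R.
  move=> H; rewrite (_ : edot x (T x) - _ + _ = f x + fs y)%R; last by lra.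
  by apply/ler_addgt0Pr.
move=> e e0; pose b0 := ((2 * L)^-1 *: a)%R.
(* x + b0 maximizes u |-> edot (u - x) a - L * edot (u - x) (u - x) *)
have [n Xn] := denseX (x + b0)%R (e / L)%R (divr_gt0 e0 L0).
pose b := (X n - (x + b0))%R; pose c := (b0 + b)%R.
have Xne : (L * edot b b <= e)%R by rewrite mulrC -ler_pdivlMr.
have XnE : (X n = x + c)%R by rewrite /c /b addrA addrC subrK.
have yE : y = (T x + a)%R by rewrite addrC subrK.
have h1 : (edot (x + c) y - f (X n) <= fs y)%R.
  by rewrite -XnE -lee_fin -conjE; exact: conj_ge.
have h2 : (f (X n) <= f x + edot (T x) c + L * edot c c)%R.
  have := convex_gradient_le cvf L0 LT Gx (gX n).
  by rewrite {2 3 4}XnE [(x + c)%R]addrC addrK.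
have h3 : (edot c a - L * edot c c = (4 * L)^-1 * edot a a - L * edot b b)%R.
  suff H (u w : Rd) : (edot ((2 * L)^-1 *: u + w) u - L * edot ((2 * L)^-1 *: u + w)
      ((2 * L)^-1 *: u + w) = (4 * L)^-1 * edot u u - L * edot w w)%R by exact: H.
  by rewrite !edotE (edotC w u); field; exact: lt0r_neq0.
have h4 : (edot (x + c) y = edot x y + edot (T x) c + edot c a)%R.
  rewrite edotDl -addrA; congr (_ + _)%R.
  by rewrite [in LHS]yE (edotDr _ _ c) (edotC c (T x)).
lra.
Qed.

(** In the Fenchel-Young inequality with remainder, the terms in [fs] have the
    same integral because [T] maps [mu0] to [mu1], and they cancel. *)
Lemma detachment (g : probability Z R) : is_coupling mu0 mu1 g ->
  \int[mu0]_x (quad_cost (x, T x))%:E +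
    (4 * L)^-1%:E * \int[g]_z (edot (z.2 - T z.1)%R (z.2 - T z.1)%R)%:E <=
  transport_cost g.
Proof.
move=> cg; have [mT _ _ _] := TP.
have [fs [mfs ifs fsP]] := brenier_conjugate.
pose B y : R := (2^-1 * edot y y - fs y)%R.
have medot : measurable_fun setT (fun y : Rd => edot y y) by exact: measurable_edot.
have mB : measurable_fun setT (fun y => (B y)%:E : \bar R).
  by apply/measurable_EFinP/measurable_funB => //; exact: measurable_funM.
have iB : mu1.-integrable setT (fun y => (B y)%:E).
  rewrite (_ : (fun y => _) = (fun y => (2^-1)%:E * (edot y y)%:E) \- (fun y => (fs y)%:E)).
    by apply: integrableB => //; apply: integrableZl => //; exact: integrable_moment2 M1P.
  by apply/funext => y; rewrite /B EFinB EFinM.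
have iBT : mu0.-integrable setT (fun x => (B (T x))%:E).
  apply/integrableP; split; first exact: (measurableT_comp mB mT).
  rewrite (brenier_integral (h := fun y => `|(B y)%:E|)).
    by case/integrableP : iB.
  exact: measurableT_comp.
have iB2 := coupling_integrable_snd cg iB.
have iBT1 := coupling_integrable_fst cg iBT.
have ix := coupling_integrable_fst cg (integrable_moment2 M0P).
have iTx := coupling_integrable_fst cg integrable_brenier.
have iy := coupling_integrable_snd cg (integrable_moment2 M1P).
have mT1 : measurable_fun setT (fun z : Z => T z.1) by exact: measurableT_comp.
have iD := integrable_edotB measurable_snd mT1 iy iTx.
have iC : g.-integrable setT (fun z => (quad_cost z)%:E).
  under eq_fun => z do rewrite quad_costE EFinM.
  apply: integrableZl => //.
  exact: (integrable_edotB measurable_fst measurable_snd ix iy).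
have iCT : g.-integrable setT (fun z => (quad_cost (z.1, T z.1))%:E).
  under eq_fun => z do rewrite quad_costE EFinM /=.
  apply: integrableZl => //.
  exact: (integrable_edotB measurable_fst mT1 ix iTx).
pose beta := \int[mu1]_y (B y)%:E.
have beta_fin : beta \is a fin_num by exact: integrable_fin_num.
have EB : \int[g]_z (B z.2)%:E = beta.
  exact: (coupling_integral_snd cg (f := fun y => (B y)%:E)).
have EBT : \int[g]_z (B (T z.1))%:E = beta.
  rewrite (coupling_integral_fst cg (f := fun x => (B (T x))%:E)).
    exact: (brenier_integral (h := fun y => (B y)%:E)).
  exact: (measurableT_comp mB mT).
have ECT : \int[g]_z (quad_cost (z.1, T z.1))%:E = \int[mu0]_x (quad_cost (x, T x))%:E.
  apply: (coupling_integral_fst cg (f := fun x => (quad_cost (x, T x))%:E)).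
  by apply/measurable_EFinP/measurable_quad_cost; exact: measurable_fun_pair.
rewrite -(leeD2rE _ _ beta_fin) /transport_cost -{2}EBT -integralD// -EB -ECT.
rewrite -integralZl// -integralD//; last exact: integrableZl.
have iCTD := integrableD measurableT iCT (integrableZl measurableT (4 * L)^-1 iD).
rewrite -integralD//.
apply: ae_le_integral.
- exact: measurable_int (integrableD measurableT iCTD iB2).
- exact: measurable_int (integrableD measurableT iC iBT1).
apply: filterS (fsP g cg) => z; rewrite -!EFinM -!EFinD lee_fin !quad_costE /B/=.
have -> : edot (z.1 - z.2) (z.1 - z.2) =
    (edot z.1 z.1 - 2 * edot z.1 z.2 + edot z.2 z.2)%R.
  by rewrite !edotE (edotC z.2 z.1); ring.
have -> : edot (z.1 - T z.1) (z.1 - T z.1) =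
    (edot z.1 z.1 - 2 * edot z.1 (T z.1) + edot (T z.1) (T z.1))%R.
  by rewrite !edotE (edotC (T z.1) z.1); ring.
lra.
Qed.

End detachment.

(** * Distance between entropic and optimal plans *)

Section wasserstein.
Context {R : realType} (d : nat).
Local Notation Rd := ('rV[R]_d).
Local Notation Z := (Rd * Rd)%type.
Variables g g' : probability Z R.

Lemma sqr_W2 : W2 g g' ^+ 2 =
  ereal_inf [set \int[p]_w (enorm2 (w.1 - w.2) ^+ 2)%:E | p in is_coupling g g'].
Proof.
rewrite /W2; set E := ereal_inf _.
have : 0 <= E.
  apply: le_ereal_inf_tmp => _ [p _ <-]; apply: integral_ge0 => w _.
  by rewrite lee_fin sqr_ge0.
case: E => [r||]//=.
  by rewrite lee_fin => r0; rewrite powR12_sqrt// -EFinM -expr2 sqr_sqrtr.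
by rewrite gt_eqF ?invr_gt0//= mulyy.
Qed.

Lemma sqr_W2_le (p : probability (Z * Z)%type R) : is_coupling g g' p ->
  W2 g g' ^+ 2 <= \int[p]_w (enorm2 (w.1 - w.2) ^+ 2)%:E.
Proof. by move=> cp; rewrite sqr_W2; apply: ereal_inf_lbound; exists p. Qed.

Lemma sqr_W2_ltP (r : R) : W2 g g' ^+ 2 < r%:E ->
  exists2 p : probability (Z * Z)%type R, is_coupling g g' p &
    \int[p]_w (enorm2 (w.1 - w.2) ^+ 2)%:E <= r%:E.
Proof.
by rewrite sqr_W2 => /ereal_inf_lt[_ [p cp <-]] /ltW; exists p.
Qed.

End wasserstein.

(** The sum of the constants in [block_approximation] and in
    [entropy_near_monotone_ge]. *)
Definition eot_const (R : realType) (d : nat) (M0 M1 h0 h1 : R) : R :=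
  (3 * d%:R * ln (Num.sqrt (2 * pi)) + 3 * (M0 + M1) + 19 + 9 * d%:R +
    d%:R / 8 + h0 + h1)%R.

Section plans.
Context {R : realType} (d : nat).
Local Notation Rd := ('rV[R]_d).
Local Notation Z := (Rd * Rd)%type.
Variables (mu0 mu1 : probability Rd R) (M0 M1 : R).
Hypothesis (M0P : \int[mu0]_x (edot x x)%:E <= M0%:E).
Hypothesis (M1P : \int[mu1]_x (edot x x)%:E <= M1%:E).

Lemma transport_cost_fin_num (g : probability Z R) : is_coupling mu0 mu1 g ->
  transport_cost g \is a fin_num.
Proof.
move=> cg; apply: integrable_fin_num => //.
under eq_fun => z do rewrite quad_costE EFinM.
apply: integrableZl => //; apply: (integrable_edotB measurable_fst measurable_snd).
  exact: (coupling_integrable_fst cg (integrable_moment2 M0P)).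
exact: (coupling_integrable_snd cg (integrable_moment2 M1P)).
Qed.

Section key_inequality.
Variables (ga g0 : probability Z R) (eps h0 h1 s : R).
Variable p : probability (Z * Z)%type R.
Hypotheses (dom0 : mu0 `<< lebesgue_rV d) (dom1 : mu1 `<< lebesgue_rV d).
Hypothesis h0P : entropy (lebesgue_rV d) mu0 = h0%:E.
Hypothesis h1P : entropy (lebesgue_rV d) mu1 = h1%:E.
Hypotheses (eps01 : (0 < eps <= 1)%R) (gaP : is_eot_plan mu0 mu1 eps ga).
Hypotheses (g0P : is_ot_plan mu0 mu1 g0) (cp : is_coupling ga g0 p) (s0 : (0 < s)%R).
Hypothesis ps : \int[p]_w (enorm2 (w.1 - w.2) ^+ 2)%:E <= (s ^+ 2)%:E.

(** Minimality of the entropic plan against the block approximation with cells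
    of size [sqrt eps], combined with the lower bound on its entropy. *)
Lemma eot_suboptimality_le :
  (fine (transport_cost ga) - fine (transport_cost g0) <=
   eps * ((3 * d%:R * ln (Num.sqrt (2 * pi)) + 3 * (M0 + M1) + 19 + 9 * d%:R +
      d%:R / 8 + h0 + h1) + d%:R * (ln s - ln (Num.sqrt eps))))%R.
Proof.
have [eps0 eps1] := andP eps01.
have r0 : (0 < Num.sqrt eps)%R by rewrite sqrtr_gt0.
have r01 : (0 < Num.sqrt eps <= 1)%R.
  by rewrite r0 -sqrtr1 ler_wsqrtr.
have cost0_fin := transport_cost_fin_num g0P.1.
have [g' [cg' costg' entg']] :=
  block_approximation g0P.1 r01 dom0 dom1 M0P M1P h0P h1P.
have mono : {ae (g0 \x g0)%E, forall z, (0 <= exchange_gain z)%R}.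
  by apply: (ot_plan_monotone g0P); rewrite ltey_eq cost0_fin.
have entga := entropy_near_monotone_ge gaP.1 cp M0P M1P mono s0 ps.
have := gaP.2 _ cg'; rewrite /eot_functional.
have costa_fin := transport_cost_fin_num gaP.1.
rewrite -(fineK costa_fin) => le1.
have sqr_r : (Num.sqrt eps ^+ 2 = eps)%R by rewrite sqr_sqrtr// ltW.
rewrite sqr_r -(fineK cost0_fin) in costg'.
have := le_trans (leeD (lexx _) (lee_wpmul2l _ entga)) (le_trans le1
  (leeD costg' (lee_wpmul2l _ entg'))).
rewrite lee_fin (ltW eps0) => /(_ isT isT).
rewrite -!EFinM -!EFinD lee_fin lnV ?posrE// => le2.
by lra.
Qed.

End key_inequality.

Section lipschitz_brenier.
Variables (T : Rd -> Rd) (L : R) (g0 ga : probability Z R).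
Hypothesis dom0 : mu0 `<< lebesgue_rV d.
Hypotheses (L0 : (0 < L)%R) (LT : elipschitz L T) (TP : is_brenier_map mu0 mu1 T).
Hypotheses (g0P : is_ot_plan mu0 mu1 g0) (cga : is_coupling mu0 mu1 ga).

Definition graph_defect (g : probability Z R) : \bar R :=
  \int[g]_z (edot (z.2 - T z.1)%R (z.2 - T z.1)%R)%:E.

Let mT : measurable_fun setT T. Proof. by case: TP. Qed.

Let mgr d' (Y : measurableType d') (u : Y -> Rd) : measurable_fun setT u ->
  measurable_fun setT (fun t => (u t, T (u t)) : Z).
Proof. by move=> mu; apply: measurable_fun_pair => //; exact: measurableT_comp. Qed.

Let mdefect : measurable_fun setT
  (fun z : Z => (edot (z.2 - T z.1)%R (z.2 - T z.1)%R)%:E : \bar R).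
Proof.
apply/measurable_EFinP; apply: measurable_edot; apply: measurable_rVB => //;
  exact: (measurableT_comp mT measurable_fst).
Qed.

Lemma ot_cost_le_brenier :
  transport_cost g0 <= \int[mu0]_x (quad_cost (x, T x))%:E.
Proof.
have [gT [gTE gTint]] := probability_image mu0 (mgr (@measurable_id _ _ _)).
have cgT : is_coupling mu0 mu1 gT.
  split=> A mA; rewrite gTE.
    by congr (mu0 _); apply/seteqP; split => x /= => [[]|].
  have [_ Tmu _ _] := TP; rewrite -Tmu//.
  by congr (mu0 _); apply/seteqP; split => x /= => [[]|].
rewrite -(gTint (fun z => (quad_cost z)%:E)); first exact: g0P.2.
exact/measurable_EFinP/measurable_quad_cost.
Qed.

Lemma graph_defect_fin_num (g : probability Z R) : is_coupling mu0 mu1 g ->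
  graph_defect g \is a fin_num.
Proof.
move=> cg; apply: integrable_fin_num => //.
apply: (integrable_edotB measurable_snd (measurableT_comp mT measurable_fst)).
  exact: (coupling_integrable_snd cg (integrable_moment2 M1P)).
exact: (coupling_integrable_fst cg (integrable_brenier M1P TP)).
Qed.

Lemma graph_defect_le : ((4 * L)^-1 * fine (graph_defect ga) <=
  fine (transport_cost ga) - fine (transport_cost g0))%R.
Proof.
have h : transport_cost g0 + (4 * L)^-1%:E * graph_defect ga <= transport_cost ga.
  by apply: le_trans (detachment dom0 M0P M1P L0 LT TP cga); apply: leeD ot_cost_le_brenier _.
rewrite -(fineK (graph_defect_fin_num cga)) -(fineK (transport_cost_fin_num cga)) in h.
rewrite -(fineK (transport_cost_fin_num g0P.1)) -EFinM -EFinD lee_fin in h.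
lra.
Qed.

(** The detachment leaves no room for the defect of an optimal plan. *)
Lemma ot_plan_on_graph : {ae g0, forall z, z.2 = T z.1}.
Proof.
have h : \int[mu0]_x (quad_cost (x, T x))%:E + (4 * L)^-1%:E * graph_defect g0 <=
    \int[mu0]_x (quad_cost (x, T x))%:E.
  by apply: le_trans (detachment dom0 M0P M1P L0 LT TP g0P.1) ot_cost_le_brenier.
have D0 : 0 <= graph_defect g0.
  by apply: integral_ge0 => z _; rewrite lee_fin edot_ge0.
have : graph_defect g0 = 0.
  have cT_fin : \int[mu0]_x (quad_cost (x, T x))%:E \is a fin_num.
    rewrite ge0_fin_numE; last first.
      by apply: integral_ge0 => x _; rewrite lee_fin quad_cost_ge0.
    apply: le_lt_trans (leeDl _ _) (le_lt_trans (detachment dom0 M0P M1P L0 LT TP g0P.1) _).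
      by rewrite mule_ge0// lee_fin invr_ge0 mulr_ge0// ltW.
    by rewrite ltey_eq (transport_cost_fin_num g0P.1).
  rewrite -(fineK cT_fin) -(fineK (graph_defect_fin_num g0P.1)) -EFinM -EFinD lee_fin in h.
  rewrite -(fineK (graph_defect_fin_num g0P.1)); congr EFin; apply/eqP.
  rewrite eq_le fine_ge0// andbT.
  have : ((4 * L)^-1 * fine (graph_defect g0) <= 0)%R by lra.
  by rewrite pmulr_rle0// invr_gt0 mulr_gt0.
rewrite /graph_defect => D00.
have : \int[g0]_z `|(edot (z.2 - T z.1)%R (z.2 - T z.1)%R)%:E| = 0.
  by rewrite -D00; apply: eq_integral => z _; rewrite gee0_abs// lee_fin edot_ge0.
move=> /(ae_eq_integral_abs g0 measurableT mdefect).1.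
apply: filterS => z /(_ I)/= [] z0; apply/eqP; rewrite -subr_eq0; apply/eqP/rowP => i.
rewrite [RHS]mxE; apply/eqP; rewrite -sqrf_eq0 expr2; apply/eqP.
apply: (psumr_eq0P (P := xpredT) (F := fun j => (z.2 - T z.1)%R ord0 j *
  (z.2 - T z.1)%R ord0 j)%R _ z0) => // j _.
by rewrite -expr2 sqr_ge0.
Qed.

(** The coupling which keeps the first coordinate and replaces the second one
    by its image under [T]. *)
Lemma graph_coupling : exists2 p : probability (Z * Z)%type R,
  is_coupling ga g0 p &
  \int[p]_w (enorm2 (w.1 - w.2) ^+ 2)%:E = graph_defect ga.
Proof.
pose phi (z : Z) : Z * Z := (z, (z.1, T z.1)).
have mphi : measurable_fun setT phi.
  by apply: measurable_fun_pair => //; exact: mgr.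
have [p [pE pint]] := probability_image ga mphi.
have cp : is_coupling ga g0 p.
  split=> A mA; rewrite pE.
    by congr (ga _); apply/seteqP; split => x /= => [[]|].
  have -> : phi @^-1` (setT `*` A) = (fun z => (z.1, T z.1)) @^-1` A.
    by apply/seteqP; split => x /= => [[]|].
  have mgA : measurable ((fun x => (x, T x)) @^-1` A).
    by rewrite -[X in measurable X]setTI; exact: (mgr (@measurable_id _ _ _)).
  have mi : measurable_fun setT (fun x : Rd => (\1_A (x, T x))%:E : \bar R).
    by apply/measurable_EFinP; apply: (measurableT_comp _ (mgr (@measurable_id _ _ _))).
  have mA1 : measurable ((fun z : Z => (z.1, T z.1)) @^-1` A).
    by rewrite -[X in measurable X]setTI; exact: (mgr measurable_fst).
  transitivity (\int[ga]_z (\1_A (z.1, T z.1))%:E); first exact/esym/integral_indicT.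
  rewrite (coupling_integral_fst cga (f := fun x => (\1_A (x, T x))%:E))//.
  rewrite -(coupling_integral_fst g0P.1 (f := fun x => (\1_A (x, T x))%:E))//.
  apply: etrans _ (integral_indicT _ mA).
  apply: ae_eq_integral => //.
  - exact: (measurableT_comp mi measurable_fst).
  - exact/measurable_EFinP/measurable_indic.
  by apply: filterS ot_plan_on_graph => -[x y] /= ->.
exists p => //; rewrite (pint (fun w => (enorm2 (w.1 - w.2) ^+ 2)%:E)).
  rewrite /graph_defect; under eq_integral => z _.
    rewrite sqr_enorm2/= subrr /edot big1 ?add0r; last by move=> i _; rewrite mxE mul0r.
    over.
  by [].
apply/measurable_EFinP; under eq_fun do rewrite sqr_enorm2.
by apply: measurable_funD; apply: measurable_edot; apply: measurable_rVB;
  do 2 (apply: measurableT_comp => //).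
Qed.

End lipschitz_brenier.

Section bounds.
Hypothesis d_gt0 : (0 < d)%N.
Variables (ga g0 : probability Z R) (eps h0 h1 : R).
Hypotheses (dom0 : mu0 `<< lebesgue_rV d) (dom1 : mu1 `<< lebesgue_rV d).
Hypothesis h0P : entropy (lebesgue_rV d) mu0 = h0%:E.
Hypothesis h1P : entropy (lebesgue_rV d) mu1 = h1%:E.
Hypotheses (eps01 : (0 < eps <= 1)%R) (gaP : is_eot_plan mu0 mu1 eps ga).
Hypothesis g0P : is_ot_plan mu0 mu1 g0.

Let C := eot_const d M0 M1 h0 h1.
Let eps0 : (0 < eps)%R. Proof. by case/andP: eps01. Qed.
Let d0 : (0 < d%:R :> R)%R. Proof. by rewrite ltr0n. Qed.

(** If the distance were smaller than [s = expR (- (C + 1) / d) * sqrt eps], then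
    [C + d * (ln s - ln (sqrt eps)) = -1] and the entropic plan would be cheaper
    than the optimal one. *)
Lemma sqr_W2_lower : (expR (- (C + 1) / d%:R) ^+ 2 * eps)%:E <= W2 ga g0 ^+ 2.
Proof.
rewrite leNgt; apply/negP => /sqr_W2_ltP[p cp].
set A := expR _; have A0 : (0 < A)%R by exact: expR_gt0.
have r0 : (0 < Num.sqrt eps)%R by rewrite sqrtr_gt0.
pose s := (A * Num.sqrt eps)%R.
have s0 : (0 < s)%R by rewrite mulr_gt0.
have -> : (A ^+ 2 * eps = s ^+ 2)%R by rewrite exprMn sqr_sqrtr// ltW.
move=> ps.
have cost_le : (fine (transport_cost g0) <= fine (transport_cost ga))%R.
  have fin := transport_cost_fin_num.
  by rewrite -lee_fin (fineK (fin _ g0P.1)) (fineK (fin _ gaP.1)); exact: g0P.2 gaP.1.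
have := eot_suboptimality_le dom0 dom1 h0P h1P eps01 gaP g0P cp s0 ps.
rewrite /s lnM ?posrE// addrK /A expRK -/(eot_const d M0 M1 h0 h1) -/C.
have -> : (eps * (C + d%:R * (- (C + 1) / d%:R)) = - eps)%R.
  by field; rewrite gt_eqF.
move=> h; have : (eps <= 0)%R by lra.
by rewrite leNgt eps0.
Qed.

Variables (T : Rd -> Rd) (L : R).
Hypotheses (L0 : (0 < L)%R) (LT : elipschitz L T) (TP : is_brenier_map mu0 mu1 T).

(** Let [E] be the defect of the entropic plan. Detachment and the bound on the
    suboptimality give [E / (4 * L) <= eps * (C + (d / 2) * ln (E / eps))], and the
    tangent line of the logarithm at [4 * L * d] absorbs half of the left-hand
    side. *)
Lemma sqr_W2_upper : W2 ga g0 ^+ 2 <=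
  (8 * L * (C + d%:R / 2 * ln (4 * L * d%:R)) * eps)%:E \/ W2 ga g0 ^+ 2 <= 0.
Proof.
have [p cp pE] := graph_coupling dom0 L0 LT TP g0P gaP.1.
have defE := fineK (graph_defect_fin_num TP gaP.1).
set E := fine _ in defE.
have W2E : W2 ga g0 ^+ 2 <= E%:E by rewrite defE -pE; exact: sqr_W2_le.
have [E0|E0] := leP E 0%R; [right|left]; first exact: le_trans W2E _.
apply: (le_trans W2E); rewrite lee_fin.
have s0 : (0 < Num.sqrt E)%R by rewrite sqrtr_gt0.
have r0 : (0 < Num.sqrt eps)%R by rewrite sqrtr_gt0.
have ps : \int[p]_w (enorm2 (w.1 - w.2) ^+ 2)%:E <= (Num.sqrt E ^+ 2)%:E.
  by rewrite pE -defE sqr_sqrtr// ltW.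
have key := eot_suboptimality_le dom0 dom1 h0P h1P eps01 gaP g0P cp s0 ps.
have low := graph_defect_le dom0 L0 LT TP g0P gaP.1; rewrite -/E in low.
rewrite -/(eot_const d M0 M1 h0 h1) -/C in key.
have ln2 (x : R) : (0 < x)%R -> (2 * ln (Num.sqrt x) = ln x)%R.
  move=> x0; rewrite -[in RHS](sqr_sqrtr (ltW x0)) lnXn ?sqrtr_gt0//.
  by rewrite mulr_natl.
have k0 : (0 < 4 * L * d%:R)%R by rewrite !mulr_gt0.
(* y = 1 at the point of contact of the tangent line *)
pose y := (E / eps / (4 * L * d%:R))%R.
have y0 : (0 < y)%R by rewrite !divr_gt0.
have lny : (ln y <= y - 1)%R.
  have h : (-1 < y - 1)%R by rewrite ltrBDr addNr.
  by have := le_ln1Dx h; rewrite [(1 + _)%R]addrC subrK.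
have lnyE : (ln y = 2 * ln (Num.sqrt E) - 2 * ln (Num.sqrt eps) - ln (4 * L * d%:R))%R.
  by rewrite /y !ln_div ?posrE ?divr_gt0// !ln2.
have h1' : (eps * (d%:R * (ln (Num.sqrt E) - ln (Num.sqrt eps))) <=
    eps * (d%:R / 2 * (y + ln (4 * L * d%:R))))%R.
  by rewrite ler_pM2l// -mulrA ler_pM2l//; lra.
have yE : (eps * (d%:R / 2 * y) = (8 * L)^-1 * E)%R.
  by rewrite /y; field; rewrite !gt_eqF.
have h2' : ((4 * L)^-1 * E = 2 * ((8 * L)^-1 * E))%R.
  by field; rewrite gt_eqF.
have : ((8 * L)^-1 * E <= eps * (C + d%:R / 2 * ln (4 * L * d%:R)))%R by lra.
by rewrite mulrC ler_pdivrMr ?mulr_gt0// => h3; rewrite (le_trans h3)//; lra.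
Qed.

End bounds.

End plans.

Lemma elipschitzW (R : realType) (d : nat) (L L' : R) (T : 'rV[R]_d -> 'rV[R]_d) :
  (L <= L')%R -> elipschitz L T -> elipschitz L' T.
Proof.
move=> LL' LT x y; apply: (le_trans (LT x y)).
by rewrite ler_wpM2r// sqrtr_ge0.
Qed.

Theorem theorem3p9 (R : realType) (d : nat) (d_gt0 : (0 < d)%N)
    (delta m0 m1 h0 h1 : R) (delta_gt0 : (0 < delta)%R) :
  exists (a : R) (b : R -> R), [/\ (0 < a)%R, forall L : R, (0 < b L)%R &
    forall (mu0 mu1 : probability 'rV[R]_d R)
      (gam : R -> probability ('rV[R]_d * 'rV[R]_d)%type R)
      (gam0 : probability ('rV[R]_d * 'rV[R]_d)%type R),
    mu0 `<< lebesgue_rV d -> mu1 `<< lebesgue_rV d ->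
    moment (2 + delta)%R mu0 = m0%:E -> moment (2 + delta)%R mu1 = m1%:E ->
    entropy (lebesgue_rV d) mu0 = h0%:E -> entropy (lebesgue_rV d) mu1 = h1%:E ->
    (forall eps : R, (0 < eps)%R -> is_eot_plan mu0 mu1 eps (gam eps)) ->
    is_ot_plan mu0 mu1 gam0 ->
    [/\ \forall eps \near 0%R^'+, (a * eps)%:E <= W2 (gam eps) gam0 ^+ 2,
        forall (T : 'rV[R]_d -> 'rV[R]_d) (L : R),
          is_brenier_map mu0 mu1 T -> elipschitz L T ->
          \forall eps \near 0%R^'+,
            (a * eps)%:E <= W2 (gam eps) gam0 ^+ 2 <= (b L * eps)%:E &
        forall T : 'rV[R]_d -> 'rV[R]_d,
          is_brenier_map mu0 mu1 T -> (exists L : R, elipschitz L T) ->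
          is_Theta (fun eps => W2 (gam eps) gam0 ^+ 2)]].
Proof.
pose C := eot_const d (1 + m0) (1 + m1) h0 h1.
pose a := (expR (- (C + 1) / d%:R) ^+ 2)%R.
pose b L0 := (let L := Num.max L0 1 in
  a + `|8 * L * (C + d%:R / 2 * ln (4 * L * d%:R))|)%R.
have a0 : (0 < a)%R by rewrite exprn_gt0// expR_gt0.
have ab L : (a <= b L)%R by rewrite lerDl.
have b0 L : (0 < b L)%R by exact: lt_le_trans (ab L).
exists a, b; split => //.
move=> mu0 mu1 gam gam0 dom0 dom1 m0P m1P h0P h1P gamP gam0P.
have M0P := moment2_le delta_gt0 m0P; have M1P := moment2_le delta_gt0 m1P.
have lower : \forall eps \near 0%R^'+, (a * eps)%:E <= W2 (gam eps) gam0 ^+ 2.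
  near=> eps; have eps0 : (0 < eps)%R by [].
  have eps1 : (eps <= 1)%R by near: eps; exact: nbhs_right_le.
  have eps01 : (0 < eps <= 1)%R by rewrite eps0.
  exact: (sqr_W2_lower M0P M1P d_gt0 dom0 dom1 h0P h1P eps01 (gamP eps eps0) gam0P).
have upper T L : is_brenier_map mu0 mu1 T -> elipschitz L T ->
    \forall eps \near 0%R^'+, W2 (gam eps) gam0 ^+ 2 <= (b L * eps)%:E.
  move=> TP LT; near=> eps; have eps0 : (0 < eps)%R by [].
  have eps1 : (eps <= 1)%R by near: eps; exact: nbhs_right_le.
  have eps01 : (0 < eps <= 1)%R by rewrite eps0.
  have L0 : (0 < Num.max L 1)%R by rewrite lt_max ltr01 orbT.
  have LT' : elipschitz (Num.max L 1%R) T.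
    by apply: elipschitzW LT; rewrite le_max lexx.
  have [|] := sqr_W2_upper M0P M1P d_gt0 dom0 dom1 h0P h1P eps01 (gamP eps eps0)
    gam0P L0 LT' TP.
    move=> /le_trans; apply; rewrite lee_fin ler_wpM2r ?(ltW eps0)//.
    by rewrite (le_trans (ler_norm _))// lerDr ltW.
  by move=> /le_trans; apply; rewrite lee_fin mulr_ge0// ltW.
split => //.
- move=> T L TP LT; apply: filterS2 lower (upper T L TP LT) => eps -> ->.
  by [].
- move=> T TP [L LT]; exists a, (b L); split => //.
  by apply: filterS2 lower (upper T L TP LT) => eps -> ->.
Unshelve. all: by end_near.
Qed.
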